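(* Fix a real number $g>0$, an integer $\beta\ge 1$, and a complex number $s$ with $s\neq 0$ and $s\notin\{q^k : k\in\mathbb Z\}$, where $q=e^{g}$; put $t=q^{\beta}=e^{\beta g}$ and use the positive roots $q^{1/2}=e^{g/2}$, $t^{1/2}=e^{\beta g/2}$. Then there exists a normalization constant $Z(g,\beta,s,p)$, a power series in $p$ considered modulo $p^2$ with complex coefficients, depending on $g,\beta,s$ but not on $i,j$, such that for all integers $i,j\ge 0$ the following identity holds modulo $O(p^2)$ (i.e. the coefficients of $p^0$ and of $p^1$ of both sides agree): $$\frac{1}{2\pi g}\int_{-\infty}^{\infty}e^{-\frac{x_1^2}{2g}}dx_1\int_{-\infty}^{\infty}e^{-\frac{x_2^2}{2g}}dx_2\;P_i\big(e^{x_1},e^{x_2}\,\big|\,p,\,p/s\big)\,P_j\big(e^{x_1},e^{x_2}\,\big|\,p,\,s\big)\prod_{m=0}^{\beta-1}\theta_p\big(q^m e^{x_1-x_2}\big)\,\theta_p\big(q^m e^{x_2-x_1}\big)$$ $$= q^{\frac{i(i+\beta)+ij+j(j+\beta)}{2}}\;P_i\big(t^{\frac12},t^{-\frac12}\big|0,0\big)\;P_j\big(t^{\frac12}q^{\frac i2},t^{-\frac12}q^{-\frac i2}\big|0,0\big)\;\frac{P_j\big(t^{\frac12}q^{\frac i2},t^{-\frac12}q^{-\frac i2}\big|\,p/s,\,s\big)}{P_j\big(t^{\frac12}q^{\frac i2},t^{-\frac12}q^{-\frac i2}\big|\,p/s,\,0\big)}\cdot Z(g,\beta,s,p)+O(p^2).$$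 Here $P_j(x_1,x_2|p,s)$ are the Shiraishi functions of type $A_1$ and $\theta_p$ is the multiplicative theta function.
   Context: Theta function: $\theta_p(x)=\prod_{n=0}^{\infty}(1-p^n x)(1-p^{n+1}/x)$, regarded as a formal power series in $p$. Shiraishi functions of type $A_1$ with index $j=0,1,2,\dots$ are the formal power series $$P_j(x_1,x_2|p,s)=x_1^j\sum_{\lambda,\mu}\frac{\mathcal N^{(0)}_{\lambda,\lambda}\left(\frac qt\right)\mathcal N^{(1)}_{\lambda,\mu}\left(\frac{qy}{t}\right)\mathcal N^{(-1)}_{\mu,\lambda}\left(\frac{q}{ty}\right)\mathcal N^{(0)}_{\mu,\mu}\left(\frac qt\right)}{\mathcal N^{(0)}_{\lambda,\lambda}(1)\,\mathcal N^{(1)}_{\lambda,\mu}(y)\,\mathcal N^{(-1)}_{\mu,\lambda}(y^{-1})\,\mathcal N^{(0)}_{\mu,\mu}(1)}\prod_{a=1}^{\ell(\lambda)}\left(\frac{tX_a}{q}\right)^{\lambda_a}\prod_{a=1}^{\ell(\mu)}\left(\frac{tX_{a+1}}{q}\right)^{\mu_a},$$ where the sum is over all pairs of partitions $\lambda=(\lambda_1\ge\lambda_2\ge\dots\ge0)$, $\mu=(\mu_1\ge\mu_2\ge\dots\ge0)$; $\ell(P)$ is the number of nonzero parts of a partition $P$ (and $P_b=0$ for $b>\ell(P)$); $$\mathcal N^{(k)}_{P,Q}(u)=\prod_{\substack{1\le a\le b\le \ell(P)\\ b-a-k\equiv0\ (2)}}\ \prod_{m=0}^{P_b-P_{b+1}-1}\left(1-u\,q^{m}q^{-Q_a+P_{b+1}}s^{\frac{b-a}{2}}\right)\times\prod_{\substack{1\le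 a\le b\le \ell(Q)\\ b-a+k+1\equiv0\ (2)}}\ \prod_{m=0}^{Q_b-Q_{b+1}-1}\left(1-u\,q^{m}q^{P_a-Q_b}s^{\frac{a-b-1}{2}}\right);$$ and $y=s^{-1/2}t^{-1}q^{-j}$, $X_a=p\,x_1/x_2$ for $a$ even, $X_a=x_2/x_1$ for $a$ odd. (Half-integer powers of $s$ cancel.) In this definition $q,t,s$ are independent indeterminates; each coefficient of $P_j(x_1,x_2|p,s)$ with respect to $p$ is a Laurent polynomial in $x_1,x_2$ whose coefficients are rational functions in $\mathbb C(q,t,s)$. Meaning of the expressions in the identity: $P_i(x_1,x_2|p,p/s)$ is obtained by substituting $s\to p/s$ in these rational coefficients and re-expanding in powers of $p$; $P_j(x_1,x_2|p/s,s)$ is obtained by the substitution $p\to p/s$; $P_j(x_1,x_2|p/s,0)$ is obtained by setting $s=0$ in the rational coefficients and then replacing $p$ by $p/s$ (with the given $s$); $P_j(x_1,x_2|0,0)$ is the coefficient of $p^0$, which does not depend on $s$. Only the coefficients of $p^0$ and $p^1$ are used; these coefficients, as rational functions in lowest terms, are then evaluated at the given numerical values $q=e^g$, $t=e^{\beta g}$ and $s$. The integral is applied to the coefficient of each power of $p$, each such coefficient being a Laurent polynomial in $e^{x_1},e^{x_2}$. *)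

(* Defs.v *)
From HB Require Import structures.
From mathcomp Require Export all_boot all_order all_algebra.
From mathcomp Require Export all_classical all_reals all_analysis.
From mathcomp Require Export complex.
Set Implicit Arguments.
Unset Strict Implicit.
Unset Printing Implicit Defensive.
Import Order.TTheory GRing.Theory Num.Theory.
Local Open Scope classical_set_scope.
Local Open Scope ring_scope.
Local Notation "x %:F" := (FracField.tofrac x).

(* A formal power series in [p] is the sequence of its coefficients. *)

Definition sone (K : fieldType) : nat -> K := fun n => (n == 0)%:R.

Definition smul (K : fieldType) (f g : nat -> K) : nat -> K :=
  fun n => \sum_(k < n.+1) f k * g (n - k)%N.

(* The first [n] coefficients of [f / g], computed by long division; this is
   the quotient of power series when [g 0] is nonzero. *)
Fixpoint sdiv_seq (K : fieldType) (f g : nat -> K) (n : nat) : seq K :=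
  if n is n'.+1 then
    let c := sdiv_seq f g n' in
    rcons c ((f n' - \sum_(k < n') c`_k * g (n' - k)%N) / g 0%N)
  else [::].

Definition sdiv (K : fieldType) (f g : nat -> K) : nat -> K :=
  fun n => (sdiv_seq f g n.+1)`_n.

(* The substitution [p -> p / s]. *)
Definition sscale (K : fieldType) (s : K) (f : nat -> K) : nat -> K :=
  fun n => f n / s ^+ n.

(* The factors with index [n > N] of the infinite product are congruent to 1
   modulo [p ^ N.+1], so they do not affect the coefficient of [p ^ N]. *)
Definition theta (K : fieldType) (x : K) : nat -> K := fun N =>
  (\prod_(n < N.+1)
     ((1 - x%:P * 'X ^+ n) * (1 - (x^-1)%:P * 'X ^+ n.+1) : {poly K}))`_N.

(* A partition is the decreasing sequence of its nonzero parts; the parts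
    [part P 1 >= part P 2 >= ...] are numbered from 1, with [part P b = 0] for
    [b > size P]. *)

Definition is_part (P : seq nat) : Prop := sorted geq P /\ 0%N \notin P.

Definition part (P : seq nat) (b : nat) : nat := nth 0%N P b.-1.

Definition odd_weight (P : seq nat) : nat :=
  (\sum_(1 <= a < (size P).+1 | odd a) part P a)%N.

Definition even_weight (P : seq nat) : nat :=
  (\sum_(1 <= a < (size P).+1 | ~~ odd a) part P a)%N.

(* [nek q s k h P Q v] is N^(k)_{P,Q}(u) at [u = v * s ^ (h / 2)].  Only
   [h = - k] is used, in which case [h + b - a] (first product) and
   [h + a - b - 1] (second product) are even, so that the halves below are exact:
   this is the cancellation of the half-integer powers of [s]. *)
Definition nek (F : fieldType) (q s : F) (k h : int) (P Q : seq nat) (v : F) : F :=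
  (\prod_(1 <= b < (size P).+1)
     \prod_(1 <= a < b.+1 | (2 %| b%:Z - a%:Z - k)%Z)
       \prod_(0 <= m < part P b - part P b.+1)
         (1 - v * q ^+ m * q ^ ((part P b.+1)%:Z - (part Q a)%:Z)
              * s ^ ((h + b%:Z - a%:Z) %/ 2)%Z))
  * (\prod_(1 <= b < (size Q).+1)
     \prod_(1 <= a < b.+1 | (2 %| b%:Z - a%:Z + k + 1)%Z)
       \prod_(0 <= m < part Q b - part Q b.+1)
         (1 - v * q ^+ m * q ^ ((part P a)%:Z - (part Q b)%:Z)
              * s ^ ((h + a%:Z - b%:Z - 1) %/ 2)%Z)).

(* The rational weight of the pair [(la, mu)]; here [y = yy * s ^ (- 1 / 2)]. *)
Definition shiraishi_term (F : fieldType) (q t s : F) (j : nat) (la mu : seq nat) : F :=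
  let yy := t^-1 * q ^- j in
  (nek q s 0 0 la la (q / t) * nek q s 1 (-1) la mu (q * yy / t)
   * nek q s (-1) 1 mu la (q / (t * yy)) * nek q s 0 0 mu mu (q / t))
  / (nek q s 0 0 la la 1 * nek q s 1 (-1) la mu yy
     * nek q s (-1) 1 mu la yy^-1 * nek q s 0 0 mu mu 1).

(* The product of the powers of [t X_a / q] attached to [(la, mu)] is
   (t / q) ^ (|la| + |mu|) * (p x_1 / x_2) ^ e * (x_2 / x_1) ^ o
   where [e] collects the parts carried by some [X_a] with [a] even, and [o]
   those carried by some [X_a] with [a] odd. *)
Definition even_deg (lm : seq nat * seq nat) : nat :=
  (even_weight lm.1 + odd_weight lm.2)%N.

Definition odd_deg (lm : seq nat * seq nat) : nat :=
  (odd_weight lm.1 + even_weight lm.2)%N.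

(* The coefficient of [p ^ k * x_1 ^ j * (x_2 / x_1) ^ d] in P_j(x_1,x_2|p,s):
   a sum over finitely many pairs of partitions.  The parameters live in an
   arbitrary field; taking [q], [t], [s] algebraically independent gives the
   rational function, and taking [p / s] for [s] substitutes [p / s] in it. *)
Definition shiraishi_coef (F : fieldType) (q t s : F) (j k : nat) (d : int) : F :=
  \sum_(lm \in [set lm : seq nat * seq nat |
                  [/\ is_part lm.1, is_part lm.2, even_deg lm = k
                    & (odd_deg lm)%:Z = k%:Z + d]])
     (t / q) ^+ (even_deg lm + odd_deg lm) * shiraishi_term q t s j lm.1 lm.2.

(* The value of a fraction at a point, [ev] being the evaluation of its numerator
   and denominator there.  The denominator in lowest terms divides any other one,
   so if some representation has a denominator that does not vanish at the point,
   then so does the representation in lowest terms, and both give this value. *)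
Definition frac_val (A : idomainType) (K : fieldType) (ev : A -> K)
    (f : {fraction A}) : K :=
  xget 0 [set v | exists n d : A,
                    [/\ ev d != 0, f = n%:F / d%:F & v = ev n / ev d]].

(* The coefficient of ['X ^ N] in the power series expansion at 0. *)
Definition frac_coef (K : fieldType) (f : {fraction {poly K}}) (N : nat) : K :=
  xget 0 [set v | exists n d : {poly K},
                    [/\ d`_0 != 0, f = n%:F / d%:F
                      & v = sdiv (fun k => n`_k) (fun k => d`_k) N]].

Definition ev_qt (K : fieldType) (q t : K) (f : {poly {poly K}}) : K :=
  f.[t%:P].[q].

Definition ev_qts (K : fieldType) (q t s : K) (f : {poly {poly {poly K}}}) : K :=
  ev_qt q t f.[s%:P%:P].

(* K(q,t): the inner variable is [q], the outer one [t]. *)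
Notation Kqt K := {fraction {poly {poly K}}}.
Definition qvar2 (K : fieldType) : Kqt K := ('X%:P)%:F.
Definition tvar2 (K : fieldType) : Kqt K := 'X%:F.

(* K(q,t,s): from the innermost to the outermost, [q], [t], [s]. *)
Notation Kqts K := {fraction {poly {poly {poly K}}}}.
Definition qvar3 (K : fieldType) : Kqts K := ('X%:P%:P)%:F.
Definition tvar3 (K : fieldType) : Kqts K := ('X%:P)%:F.
Definition svar3 (K : fieldType) : Kqts K := 'X%:F.

Definition cst (L : fieldType) (c : L) : {fraction {poly L}} := (c%:P)%:F.

(* The numerical coefficient of [p ^ N * x_1 ^ j * (x_2 / x_1) ^ d] in
   P_j(x_1,x_2|p,s) at the numbers [q], [t], [s]; the next two definitions do the
   same for P_j(x_1,x_2|p,0) and P_j(x_1,x_2|p,p/s). *)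
Definition coef_s (K : fieldType) (q t s : K) (j N : nat) (d : int) : K :=
  frac_val (ev_qts q t s)
    (shiraishi_coef (qvar3 K) (tvar3 K) (svar3 K) j N d).

(* First set [s = 0] in K(q,t)(s), and only then evaluate at [q], [t]. *)
Definition coef_0 (K : fieldType) (q t : K) (j N : nat) (d : int) : K :=
  frac_val (ev_qt q t)
    (frac_val (fun f : {poly Kqt K} => f.[0])
       (shiraishi_coef (cst (qvar2 K)) (cst (tvar2 K)) ('X%:F) j N d)).

(* The substitution takes place in K(q,t,s)(p), where the variable
   'X is [p]; the result is expanded at [p = 0], then evaluated.  All rational
   coefficients are regular at [s = 0], so the terms of index [k > N] are
   multiples of [p ^ N.+1]. *)
Definition coef_ps (K : fieldType) (q t s : K) (j N : nat) (d : int) : K :=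
  frac_val (ev_qts q t s)
    (frac_coef
       (\sum_(k < N.+1)
          'X%:F ^+ k * shiraishi_coef (cst (qvar3 K)) (cst (tvar3 K))
                         ('X%:F / cst (svar3 K)) j k d) N).

(* The sum over [int] is meaningful because [c] has finite support: the
   coefficient of each power of [p] is a Laurent polynomial. *)
Definition laurent (K : fieldType) (j : nat) (c : int -> K) (x1 x2 : K) : K :=
  x1 ^+ j * \sum_(d \in [set: int]) c d * (x2 / x1) ^ d.

Definition P_s (K : fieldType) (q t s : K) (j : nat) (x1 x2 : K) : nat -> K :=
  fun N => laurent j (coef_s q t s j N) x1 x2.

Definition P_0 (K : fieldType) (q t : K) (j : nat) (x1 x2 : K) : nat -> K :=
  fun N => laurent j (coef_0 q t j N) x1 x2.

Definition P_ps (K : fieldType) (q t s : K) (j : nat) (x1 x2 : K) : nat -> K :=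
  fun N => laurent j (coef_ps q t s j N) x1 x2.

Definition P_00 (K : fieldType) (q t : K) (j : nat) (x1 x2 : K) : K :=
  P_0 q t j x1 x2 0%N.

Definition cintegral (R : realType) (f : R -> R[i]) : R[i] :=
  Complex (\int[lebesgue_measure]_(x in [set: R]) complex.Re (f x))
          (\int[lebesgue_measure]_(x in [set: R]) complex.Im (f x)).

Definition gauss_integral2 (R : realType) (g : R) (F : R -> R -> R[i]) : R[i] :=
  real_complex R (2 * pi * g)^-1 *
  cintegral (fun x1 => real_complex R (expR (- (x1 ^+ 2 / (2 * g)))) *
    cintegral (fun x2 => real_complex R (expR (- (x2 ^+ 2 / (2 * g)))) * F x1 x2)).

(* Main.v *)
(** Only finitely many families of pairs of partitions contribute to the coefficients of
    [p ^ 0] and [p ^ 1].  The coefficient of [p ^ 0] in P_j is the monic Rogers (type A_1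
    Macdonald) polynomial M_j, and the coefficient of [p] is a combination of M_(j+2),
    x_1 x_2 M_j and (x_1 x_2)^2 M_(j-2), divided by x_1 x_2, in which [s] enters only through
    three simple weights that become 1 at [s = 0], where the combination collapses to a
    multiple of (x_1 + x_2)^2 M_j / (x_1 x_2).

    The Gaussian functional L satisfies L(x_1 F) = q^(1/2) L(F(q x_1, x_2)).  With it, the
    q-shifts of the Macdonald operator acting on M_j can be moved onto M_i, where they become
    a raising relation; the eigenvalue equation for M_j thus gives a three-term recursion in
    [i] for L(M_i M_j Delta), which is the Pieri rule at the spectral point of [j].  This
    proves the identity at order [p ^ 0].

    At order [p], the theta functions contribute - kappa ((x_1 + x_2)^2 / (x_1 x_2) - 2).  If A
    is the common prefactor of the coefficient of [p] in P_j, then A - kappa = - (t / q) A,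
    and the three terms match one by one; what is left over is Z_1 = 2 kappa Z_0. *)

Require Import Defs.
From mathcomp Require Import ring zify.
Set Implicit Arguments.
Unset Strict Implicit.
Unset Printing Implicit Defensive.
Import Order.TTheory GRing.Theory Num.Theory.
Local Open Scope ring_scope.

(** At [t = q ^ beta] single summands of P_j can be 0 / 0, through factors [1 - t * q ^ z] with
    [z < 0]. The sums are therefore simplified over a field where [q], [t], [s] are merely
    multiplicatively independent, which suffices because each factor of a denominator is, up to a
    monomial, [1] minus a nontrivial monomial. One computation then serves K(q,t,s), K(q,t)(s) and
    the substitution of [p / s] for [s]; only its simplified result is specialized to numbers. Since
    the coefficient of p ^ 0 is free of [s], replacing [s] by [p / s] just evaluates the coefficient
    of p at [s = 0]. The Gaussian functional enters only through its values on monomials, so the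
    pairing argument is algebra over a field. The Macdonald operator has the denominator x_1 - x_2,
    which would leave the Laurent polynomials; it is absorbed by the kernel, which x_1 - x_2
    divides. The recursion in [i] needs a starting value at [i = 0] for every [j]: the case [j = 0]
    supplies it, by symmetry of the pairing. *)

Section SmallPartitions.

(** * Nekrasov factors of the few shapes of partitions that occur *)

Variables (F : fieldType) (q t s : F).
Hypotheses (q_neq0 : q != 0) (s_neq0 : s != 0).

Lemma prod_nat1_1 (P : pred nat) (f : nat -> F) : \prod_(1 <= a < 1 | P a) f a = 1.
Proof. by rewrite big_geq. Qed.

Lemma prod_nat1_2 (P : pred nat) (f : nat -> F) :
  \prod_(1 <= a < 2 | P a) f a = (if P 1%N then f 1%N else 1).
Proof. by rewrite /index_iota /= big_cons big_nil mulr1. Qed.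

Lemma prod_nat1_3 (P : pred nat) (f : nat -> F) :
  \prod_(1 <= a < 3 | P a) f a =
  (if P 1%N then f 1%N else 1) * (if P 2%N then f 2%N else 1).
Proof.
by rewrite /index_iota /= !big_cons big_nil; do 2 case: ifP; rewrite ?(mulr1, mul1r).
Qed.

Lemma prod_nat1_4 (P : pred nat) (f : nat -> F) :
  \prod_(1 <= a < 4 | P a) f a =
  (if P 1%N then f 1%N else 1) * (if P 2%N then f 2%N else 1)
    * (if P 3%N then f 3%N else 1).
Proof.
rewrite /index_iota /= !big_cons big_nil.
by do 3 case: ifP; rewrite ?(mulr1, mul1r, mulrA).
Qed.

Definition qfall (v : F) (n : nat) : F := \prod_(l < n) (1 - v / q ^+ l.+1).

Lemma qfall0 v : qfall v 0 = 1.
Proof. by rewrite /qfall big_ord0. Qed.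

Lemma qfall1 v : qfall v 1 = 1 - v / q.
Proof. by rewrite /qfall big_ord1 expr1. Qed.

Lemma qfallS v n : qfall v n.+1 = qfall v n * (1 - v / q ^+ n.+1).
Proof. by rewrite /qfall big_ord_recr. Qed.

Lemma qfallSl v n : qfall v n.+1 = (1 - v / q) * qfall (v / q) n.
Proof.
rewrite /qfall big_ord_recl expr1; congr (_ * _).
by apply: eq_bigr => i _; rewrite lift0 [q ^+ i.+2]exprS invfM mulrA.
Qed.

(** The factors are read from the last to the first. In this form all factors start from the same
    argument whatever [n] is, so that quotients of two such products can be computed factor by
    factor. *)
Lemma prod_qfall v n (e : int) x :
  \prod_(0 <= m < n) (1 - v * q ^+ m * q ^ e * x) = qfall (v * q ^ (e + n%:Z) * x) n.
Proof.
rewrite /qfall big_mkord (reindex_inj rev_ord_inj) /=.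
apply: eq_bigr => i _; congr (1 - _).
have -> : q ^ (e + n%:Z) = q ^ e * (q ^+ i.+1 * q ^+ (n - i.+1)).
  by rewrite expfzDr// -exprD subnKC.
have qi : q ^+ i.+1 != 0 by rewrite expf_neq0.
rewrite -[LHS](mulfK qi); congr (_ / _); ring.
Qed.

Definition row (n : nat) : seq nat := if n is 0 then [::] else [:: n].

Ltac nek_simp :=
  rewrite /nek /= ?(prod_nat1_1, prod_nat1_2, prod_nat1_3, prod_nat1_4) //= /part /=
    ?prod_qfall ?subSS ?subn0 ?subnn ?qfall1 ?qfall0 ?mulr1 ?mul1r ?expr0z //;
  repeat match goal with |- context [(?a %/ 2)%Z] =>
    first [ rewrite (_ : (a %/ 2)%Z = 0); last reflexivity
          | rewrite (_ : (a %/ 2)%Z = 1); last reflexivity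
          | rewrite (_ : (a %/ 2)%Z = -1); last reflexivity ]
    end;
  repeat match goal with |- context [q ^ (?a - ?c + ?b)] =>
    first [ rewrite (_ : a - c + b = 0 :> int); last (by lia)
          | rewrite (_ : a - c + b = 1 :> int); last (by lia)
          | rewrite (_ : a - c + b = -1 :> int); last (by lia)
          | rewrite (_ : a - c + b = a); last (by lia) ]
    end;
  rewrite ?expr0z ?expr1z ?exprN1 ?mulr1.

Lemma nek0_row n v : nek q s 0 0 (row n) (row n) v = qfall v n.
Proof. by case: n => [|n]; nek_simp. Qed.

Lemma nek1_row n v : nek q s 1 (-1) (row n) [::] v = 1.
Proof. by case: n => [|n]; nek_simp. Qed.

Lemma nekN1_row n v : nek q s (-1) 1 [::] (row n) v = qfall v n.
Proof. by case: n => [|n]; nek_simp. Qed.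

Lemma nek0_row1 m v :
  nek q s 0 0 [:: m.+1; 1%N] [:: m.+1; 1%N] v
  = qfall v m * (1 - v / q) * (1 - v * q ^+ m / s).
Proof. by nek_simp; rewrite -exprnP exprS; field; rewrite q_neq0 s_neq0. Qed.

Lemma nek1_row1 m v : nek q s 1 (-1) [:: m.+1; 1%N] [::] v = 1 - v.
Proof. by nek_simp; rewrite mulfK. Qed.

Lemma nekN1_row1 m v :
  nek q s (-1) 1 [::] [:: m.+1; 1%N] v = qfall v m.+1.
Proof. by nek_simp; rewrite qfallSl mulrC. Qed.

Lemma nek0_row11 m v :
  nek q s 0 0 [:: m.+1; 1%N; 1%N] [:: m.+1; 1%N; 1%N] v
  = qfall v m * (1 - v * s / q ^+ m.+1) * (1 - v / q) * (1 - v / s).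
Proof.
nek_simp; rewrite (_ : 0 - m.+1%:Z + 1 = - m%:Z); last by lia.
have qm : q ^+ m != 0 by rewrite expf_neq0.
by rewrite -exprnN exprS; field; rewrite q_neq0 s_neq0 qm.
Qed.

Lemma nek1_row11 m v : nek q s 1 (-1) [:: m.+1; 1%N; 1%N] [::] v = 1 - v.
Proof. by nek_simp; rewrite mulfK. Qed.

Lemma nekN1_row11 m v :
  nek q s (-1) 1 [::] [:: m.+1; 1%N; 1%N] v = qfall v m.+1 * (1 - v / q / s).
Proof. by nek_simp; rewrite qfallSl; field; rewrite q_neq0 s_neq0. Qed.

Lemma nek1_row_1 n v : nek q s 1 (-1) (row n) [:: 1%N] v = 1 - v * q ^+ n / q / s.
Proof. by case: n => [|n]; nek_simp; rewrite -?exprnP; field; rewrite q_neq0 s_neq0. Qed.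

Lemma nekN1_1_row n v : nek q s (-1) 1 [:: 1%N] (row n) v = qfall (q * v) n.
Proof. by case: n => [|n]; nek_simp; rewrite // mulrC. Qed.

Lemma nek0_11 v :
  nek q s 0 0 [:: 1%N; 1%N] [:: 1%N; 1%N] v = (1 - v / q) * (1 - v / s).
Proof. by nek_simp; field; rewrite q_neq0 s_neq0. Qed.

Lemma nek1_row_11 n v : nek q s 1 (-1) (row n) [:: 1%N; 1%N] v = 1 - v / q / s.
Proof. by case: n => [|n]; nek_simp; field; rewrite q_neq0 s_neq0. Qed.

Lemma nekN1_11_row n v :
  nek q s (-1) 1 [:: 1%N; 1%N] (row n) v = (1 - v * s / q ^+ n) * qfall (q * v) n.
Proof.
case: n => [|n]; nek_simp; first by rewrite expr0 divr1 mulrAC mulfK.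
rewrite (_ : 0 - n.+1%:Z + 1 = - n%:Z); last by lia.
have qn : q ^+ n != 0 by rewrite expf_neq0.
by rewrite -exprnN exprS [v * q]mulrC; field; rewrite q_neq0 qn.
Qed.

End SmallPartitions.

(** * Pairs of partitions that contribute to p ^ 0 and p ^ 1 *)

Section Weights.

Lemma odd_weight_nil : odd_weight [::] = 0%N.
Proof. by rewrite /odd_weight big_geq. Qed.

Lemma even_weight_nil : even_weight [::] = 0%N.
Proof. by rewrite /even_weight big_geq. Qed.

Lemma odd_weight_cons a P : odd_weight (a :: P) = (a + even_weight P)%N.
Proof.
rewrite /odd_weight /even_weight /= big_mkcond big_ltn // [X in _ = (_ + X)%N]big_mkcond /=.
by rewrite big_add1 /=; congr (_ + _)%N; apply: eq_big_nat => -[|b].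
Qed.

Lemma even_weight_cons a P : even_weight (a :: P) = odd_weight P.
Proof.
rewrite /odd_weight /even_weight /= big_mkcond big_ltn // [RHS]big_mkcond /=.
by rewrite big_add1 /= add0n; apply: eq_big_nat => -[|b] //= _; rewrite negbK.
Qed.

Definition weightE :=
  (odd_weight_nil, even_weight_nil, odd_weight_cons, even_weight_cons).

Lemma is_part_cons a P :
  is_part (a :: P) <-> [/\ (0 < a)%N, (head 0%N P <= a)%N & is_part P].
Proof.
rewrite /is_part in_cons negb_or [0%N == a]eq_sym -lt0n.
case: P => [|b P]; first by split=> [[_ /andP[]]|[-> _ [_ ->]]].
rewrite /=; split; first by case=> /andP[ba bP] /andP[a0 nP].
by case=> -> -> [-> ->].
Qed.

Lemma is_part_row n : is_part (row n).
Proof. by case: n => [|n]; split. Qed.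

Lemma odd_weight_row n : odd_weight (row n) = n.
Proof. by case: n => [|n]; rewrite /= !weightE ?addn0. Qed.

Lemma even_weight_row n : even_weight (row n) = 0%N.
Proof. by case: n => [|n]; rewrite /= !weightE ?addn0. Qed.

Lemma odd_weight_eq0 P : is_part P -> odd_weight P = 0%N -> P = [::].
Proof.
case: P => [//|a P] /is_part_cons[a0 _ _]; rewrite weightE => /eqP.
by rewrite addn_eq0; case: a a0.
Qed.

Lemma even_weight_eq0 P : is_part P -> even_weight P = 0%N -> P = row (odd_weight P).
Proof.
case: P => [|a P]; rewrite !weightE // => /is_part_cons[a0 _ pP] /(odd_weight_eq0 pP) ->.
by rewrite weightE addn0; case: a a0.
Qed.

Lemma odd_weight_eq1 P : is_part P -> odd_weight P = 1%N -> P = [:: 1%N] \/ P = [:: 1%N; 1%N].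
Proof.
case: P => [|a P]; rewrite !weightE // => /is_part_cons[a0 aP pP] w.
have a1 : a = 1%N by lia.
have /(even_weight_eq0 pP) : even_weight P = 0%N by lia.
move: (odd_weight P) aP => n aP PE; rewrite {}PE {}a1 in aP *.
by case: n aP => [|[|n]] // _; [left|right].
Qed.

(** Here [n] is the odd degree. The single unit of even degree is the first row of [mu] or the
    second row of [la]; either may be followed by one more row of length 1, which counts as odd
    degree and shortens the first row of [la] accordingly. *)
Definition level1 (n : nat) : seq (seq nat * seq nat) :=
  (row n, [:: 1%N]) ::
  (if n is m.+1 then
     ([:: m.+1; 1%N], [::]) :: (row m, [:: 1%N; 1%N]) ::
     (if m is l.+1 then [:: ([:: l.+1; 1%N; 1%N], [::])] else [::])
   else [::]).

Lemma level1_uniq n : uniq (level1 n).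
Proof.
by case: n => [|[|n]] //=; rewrite !inE !xpair_eqE /= ?eqseq_cons /= ?andbF ?andbT ?orbF.
Qed.

Lemma level0P (d : int) (lm : seq nat * seq nat) :
  [/\ is_part lm.1, is_part lm.2, even_deg lm = 0%N & (odd_deg lm)%:Z = 0%:Z + d] <->
  lm = (row `|d|, [::]) /\ 0 <= d.
Proof.
case: lm => la mu; rewrite /even_deg /odd_deg /=; split.
  case=> pla pmu; move/eqP; rewrite addn_eq0 => /andP[/eqP/(even_weight_eq0 pla) -> /eqP].
  move/(odd_weight_eq0 pmu) ->; rewrite !weightE odd_weight_row addn0 add0r => <-.
  by [].
case=> -[-> ->] d0; split; rewrite ?weightE ?odd_weight_row ?even_weight_row //.
- exact: is_part_row.
- by rewrite addn0 gez0_abs// add0r.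
Qed.

Lemma even_weight_eq1 P : is_part P -> even_weight P = 1%N ->
  exists n, P = [:: n.+1; 1%N] \/ P = [:: n.+1; 1%N; 1%N].
Proof.
case: P => [|a P]; rewrite !weightE // => /is_part_cons[a0 aP pP] /(odd_weight_eq1 pP).
by case: a a0 aP => // a _ _ [] ->; exists a; [left|right].
Qed.

Lemma level1P (d : int) (lm : seq nat * seq nat) :
  [/\ is_part lm.1, is_part lm.2, even_deg lm = 1%N & (odd_deg lm)%:Z = 1%:Z + d] <->
  lm \in level1 `|d + 1| /\ 0 <= d + 1.
Proof.
case: lm => la mu; rewrite /even_deg /odd_deg /=; split.
  case=> pla pmu.
  case e : (even_weight la) => [|[|?]]; case o : (odd_weight mu) => [|[|?]] //= _.
    move: (even_weight_eq0 pla e); move: (odd_weight la) => n -> {pla e la}.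
    have [-> | ->] := odd_weight_eq1 pmu o; rewrite !weightE [1%:Z + d]addrC => <-.
      by rewrite addn0; split => //; rewrite inE eqxx.
    by rewrite addn0 addn1; split => //; rewrite !inE eqxx !orbT.
  have [n [-> | ->]] := even_weight_eq1 pla e.
    rewrite (odd_weight_eq0 pmu o) !weightE !addn0 [1%:Z + d]addrC => <-; split => //.
    by rewrite !inE eqxx orbT.
  rewrite (odd_weight_eq0 pmu o) !weightE !addn0 [1%:Z + d]addrC addn1 => <-; split => //.
  by rewrite !inE eqxx !orbT.
rewrite [1%:Z + d]addrC; case=> + d0; rewrite -{2}(gez0_abs d0).
have row1 : is_part [:: 1%N] by split.
have row11 : is_part [:: 1%N; 1%N] by split.
have row0 : is_part [::] by split.
rewrite inE => /orP[/eqP[-> ->]|].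
  by rewrite !weightE odd_weight_row even_weight_row !addn0; split=> //; exact: is_part_row.
case: `|_|%N => [//|n]; rewrite inE => /orP[/eqP[-> ->]|].
  by rewrite !weightE !addn0.
rewrite inE => /orP[/eqP[-> ->]|].
  rewrite !weightE odd_weight_row even_weight_row; split=> //; first exact: is_part_row.
  by rewrite addn0 addn1.
case: n => [//|n]; rewrite inE => /eqP[-> ->].
by rewrite !weightE !addn0 addn1.
Qed.
End Weights.

Ltac nz :=
  repeat (apply/andP; split);
  first [assumption | exact: oner_neq0 | rewrite -oppr_eq0 opprB; assumption].

Lemma neq0_of_div (F : fieldType) (d x y : F) : y != 0 -> y = x / d -> x != 0.
Proof. by move=> y0 E; apply: contraNneq y0; rewrite E => ->; rewrite mul0r. Qed.

(** * Summands of P_j for multiplicatively independent parameters *)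

Section Coefficients.
Variables (F : fieldType) (q t s : F).

(** Weaker than algebraic independence, but enough to keep [1] minus a nontrivial monomial away from
    0, and easy to check for each of the function fields in use. *)
Definition mult_indep : Prop :=
  [/\ q != 0, t != 0, s != 0 &
      forall a b c : int, q ^ a * t ^ b * s ^ c = 1 -> [/\ a = 0, b = 0 & c = 0]].

(* [rfact n] is (t; q)_n / (q; q)_n, and 0 for negative [n]. *)
Definition rfact (z : int) : F :=
  if z is Posz n then \prod_(l < n) ((1 - t * q ^+ l) / (1 - q ^+ l.+1)) else 0.

(* The coefficient of x_1 ^ (j - n) * x_2 ^ n in the monic Rogers polynomial of degree j. *)
Definition rogers (j : nat) (n : int) : F := rfact n * rfact (j%:Z - n) / rfact j.

(* The definition gives [pieri 0 = 0] even if [t = q], as [0 / 0 = 0]. *)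
Definition pieri (j : nat) : F :=
  (1 - q ^+ j) * (1 - t ^+ 2 * q ^+ j / q) / ((1 - t * q ^+ j) * (1 - t * q ^+ j / q)).

Hypothesis indep : mult_indep.

Let q_neq0 : q != 0. Proof. by case: indep. Qed.
Let t_neq0 : t != 0. Proof. by case: indep. Qed.
Let s_neq0 : s != 0. Proof. by case: indep. Qed.

Lemma indep_neq1 (a b c : int) :
  (a, b, c) != (0, 0, 0) -> 1 - q ^ a * t ^ b * s ^ c != 0.
Proof.
case: indep => _ _ _ H; apply: contra; rewrite subr_eq0 eq_sym => /eqP/H[-> -> ->].
by rewrite eqxx.
Qed.

Lemma one_sub_q (n : nat) : 1 - q ^+ n.+1 != 0.
Proof. by have := @indep_neq1 n.+1 0 0; rewrite !expr0z !mulr1; apply. Qed.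

Lemma one_sub_tq (z : int) : 1 - t * q ^ z != 0.
Proof.
have := @indep_neq1 z 1 0; rewrite expr0z !mulr1 mulrC; apply.
by rewrite !xpair_eqE andbF.
Qed.

Lemma one_sub_tqn (n : nat) : 1 - t * q ^+ n != 0.
Proof. exact: (one_sub_tq n). Qed.

Lemma rfactS (n : nat) :
  rfact n.+1%:Z = rfact n%:Z * ((1 - t * q ^+ n) / (1 - q ^+ n.+1)).
Proof. by rewrite /rfact big_ord_recr. Qed.

Lemma rfact0 : rfact 0%N = 1.
Proof. by rewrite /rfact big_ord0. Qed.

Lemma rfact_neq0 (n : nat) : rfact n != 0.
Proof.
elim: n => [|n IH]; first by rewrite rfact0 oner_neq0.
by rewrite rfactS !mulf_neq0 ?invr_neq0 ?one_sub_q// one_sub_tqn.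
Qed.

(** Valid for all integers: at [z = 0] the factor [1 - q ^ z] vanishes, in agreement with
    [rfact (-1) = 0], and below that both sides are 0. *)
Lemma rfact_pred (z : int) : rfact (z - 1) = rfact z * (1 - q ^ z) / (1 - t * (q ^ z / q)).
Proof.
case: z => [[|n]|n]; rewrite ?expr0z ?subrr ?mulr0 ?mul0r//.
rewrite -exprnP exprS [_ / q]mulrAC mulfV // mul1r -exprS -[q ^+ n.+1]exprnP.
have -> : n.+1%:Z - 1 = n by lia.
rewrite rfactS; have := one_sub_q n; have := one_sub_tqn n.
move: (q ^+ n.+1) (q ^+ n) => a b hb ha; field.
by rewrite ha hb.
Qed.

(** Inverting [q] and [t] in each factor costs [q / t]; these powers cancel the [t / q] in the
    definition of P_j. *)
Lemma qfall_ratio1 n : qfall q (q / t) n / qfall q 1 n = (q / t) ^+ n * rfact n.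
Proof.
elim: n => [|n IH]; first by rewrite !qfall0 rfact0 expr0 divr1 mulr1.
rewrite !qfallS invfM mulrACA IH rfactS !exprS.
have := one_sub_q n; rewrite exprS; have := expf_neq0 n q_neq0.
move: (q ^+ n) => a ha hb.
by field; nz.
Qed.

(** The special value of y makes the numerator the product of [1 - q ^ (j - l)] for [l < n], which
    vanishes once [n > j]: this truncates the series to a polynomial. The denominators then contain
    [1 - t * q ^ z] with negative [z]. *)
Lemma qfall_ratio2 (j n : nat) :
  qfall q (q * q ^+ j) n / qfall q (t * q ^+ j) n = rfact (j%:Z - n%:Z) / rfact j.
Proof.
elim: n => [|n IH]; first by rewrite !qfall0 subr0 !divff ?oner_neq0 ?rfact_neq0.
rewrite !qfallS invfM mulrACA IH.
have -> : j%:Z - n.+1%:Z = j%:Z - n%:Z - 1 by lia.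
rewrite rfact_pred.
have := one_sub_tq (j%:Z - n%:Z - 1).
rewrite !expfzDr// exprN1 -!exprnN exprS -!exprnP.
have := expf_neq0 n q_neq0; have := rfact_neq0 j.
move: (q ^+ n) (q ^+ j) (rfact _) (rfact _) => a b c d hc ha hb.
have hb' : a * q - t * b != 0 by apply: (neq0_of_div (d := a * q) hb); field; nz.
by field; nz.
Qed.


Local Notation Q j := (q ^+ j).
Local Notation B := ((1 - t^-1) / (1 - q^-1)).

Lemma nek00 v : nek q s 0 0 [::] [::] v = 1.
Proof. by rewrite (nek0_row q_neq0 s_neq0 0) qfall0. Qed.

Lemma scaled_ratio1 k n :
  (t / q) ^+ (n + k) * (qfall q (q / t) n / qfall q 1 n) = (t / q) ^+ k * rfact n.
Proof.
rewrite qfall_ratio1 addnC exprD -mulrA; congr (_ * _); rewrite mulrA -exprMn mulrA divfK //.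
by rewrite divff // expr1n mul1r.
Qed.

Lemma arg1 j : q / (t * (t^-1 / Q j)) = q * Q j.
Proof. by have := expf_neq0 j q_neq0; move: (Q j) => a a0; field; nz. Qed.

Lemma arg2 j : (t^-1 / Q j)^-1 = t * Q j.
Proof. by rewrite invfM !invrK. Qed.

Definition argE := (arg1, arg2, nek00).

Lemma shiraishi_row j n :
  (t / q) ^+ n * shiraishi_term q t s j (row n) [::] = rogers j n.
Proof.
rewrite /shiraishi_term /rogers !argE.
rewrite !nek0_row // !nek1_row // !nekN1_row // !mulr1.
rewrite -mulf_div qfall_ratio2 -{1}[n]addn0 mulrA scaled_ratio1.
by rewrite expr0 mul1r mulrA.
Qed.

Lemma shiraishi_row1 j m (n := m.+1) :
  (t / q) ^+ n.+1 * shiraishi_term q t s j [:: n; 1%N] [::]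
  = (t / q) ^+ 2 * B * (rfact m * (rfact (j%:Z - n%:Z) / rfact j))
    * ((1 - q ^+ n / (t * s)) / (1 - q ^+ m / s))
    * ((1 - q / (t ^+ 2 * Q j)) / (1 - (t * Q j)^-1)).
Proof.
rewrite /shiraishi_term !argE !nek0_row1 // !nek1_row1 // !nekN1_row1 // /n -addn2.
rewrite -qfall_ratio2.
set x := (X in _ = _ * _ * (_ * X) * _ * _).
rewrite [RHS](_ : _ = (t / q) ^+ 2 * rfact m * (B * x * ((1 - q ^+ m.+1 / (t * s)) / (1 - q ^+ m / s))
   * ((1 - q / (t ^+ 2 * Q j)) / (1 - (t * Q j)^-1)))); last by ring.
rewrite -scaled_ratio1 {}/x.
have -> : q / t / q = t^-1 by rewrite mulrAC divff // mul1r.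
have -> : q * (t^-1 / Q j) / t = q / (t ^+ 2 * Q j) by rewrite !invfM; ring.
have -> : q / t * Q m / s = Q m.+1 / (t * s) by rewrite exprS invfM; ring.
rewrite ?mulr1 ?mul1r !invfM; ring.
Qed.

Lemma shiraishi_row_1 j n :
  (t / q) ^+ n.+1 * shiraishi_term q t s j (row n) [:: 1%N]
  = (t / q) * B * (rfact n * (rfact (j.+1%:Z - n%:Z) / rfact j.+1))
    * ((1 - q ^+ n / (t ^+ 2 * Q j * s)) / (1 - q ^+ n / (q * t * Q j * s))).
Proof.
rewrite /shiraishi_term !argE -[[:: 1%N]]/(row 1) !nek0_row //.
rewrite !nek1_row_1 // !nekN1_1_row // !qfall1 -addn1 -qfall_ratio2.
set x := (X in _ = _ * _ * (_ * X) * _).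
rewrite [RHS](_ : _ = (t / q) ^+ 1 * rfact n * (B * x *
  ((1 - q ^+ n / (t ^+ 2 * Q j * s)) / (1 - q ^+ n / (q * t * Q j * s))))); last by ring.
rewrite -scaled_ratio1 {}/x.
have -> : q / t / q = t^-1 by rewrite mulrAC divff // mul1r.
have -> : q * (t^-1 / Q j) / t * Q n / q / s = Q n / (t ^+ 2 * Q j * s).
  by have := expf_neq0 j q_neq0; move: (Q j) => a a0; field; nz.
have -> : t^-1 / Q j * Q n / q / s = Q n / (q * t * Q j * s).
  by have := expf_neq0 j q_neq0; move: (Q j) => a a0; field; nz.
rewrite [q ^+ j.+1]exprS [t * (q * _)]mulrCA ?mulr1 ?mul1r !invfM; ring.
Qed.

Lemma shiraishi_row11 j m (n := m.+1) :
  (t / q) ^+ n.+2 * shiraishi_term q t s j [:: n; 1%N; 1%N] [::]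
  = (t / q) ^+ 3 * B * (rfact m * (rfact (j%:Z - n%:Z) / rfact j))
    * ((1 - q * s / (t * q ^+ n)) / (1 - s / q ^+ n))
    * ((1 - q / (t * s)) / (1 - s^-1))
    * ((1 - q / (t ^+ 2 * Q j)) / (1 - (t * Q j)^-1))
    * ((1 - Q j / s) / (1 - t * Q j / (q * s))).
Proof.
rewrite /shiraishi_term !argE !nek0_row11 // !nek1_row11 // !nekN1_row11 // /n -addn3.
rewrite -qfall_ratio2.
set x := (X in _ = _ * _ * (_ * X) * _ * _ * _ * _).
set y := (X in _ = _ * X).
rewrite [RHS](_ : _ = (t / q) ^+ 3 * rfact m * (B * x
   * ((1 - q * s / (t * q ^+ m.+1)) / (1 - s / q ^+ m.+1))
   * ((1 - q / (t * s)) / (1 - s^-1))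
   * ((1 - q / (t ^+ 2 * Q j)) / (1 - (t * Q j)^-1)) * y)); last by ring.
rewrite -scaled_ratio1 {}/x {}/y.
have -> : q / t / q = t^-1 by rewrite mulrAC divff // mul1r.
have -> : q * (t^-1 / Q j) / t = q / (t ^+ 2 * Q j) by rewrite !invfM; ring.
have -> : q / t / s = q / (t * s) by rewrite invfM; ring.
have -> : q / t * s / Q m.+1 = q * s / (t * Q m.+1) by rewrite invfM; ring.
have -> : q * Q j / q / s = Q j / s by rewrite [q * _]mulrC mulfK.
have -> : t * Q j / q / s = t * Q j / (q * s) by rewrite [(q * s)^-1]invfM mulrA.
rewrite ?mulr1 ?mul1r !invfM; ring.
Qed.

Lemma shiraishi_row_11 j n :
  (t / q) ^+ n.+2 * shiraishi_term q t s j (row n) [:: 1%N; 1%N]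
  = (t / q) ^+ 2 * B * (rfact n * (rfact (j.+1%:Z - n%:Z) / rfact j.+1))
    * ((1 - q / (t * s)) / (1 - s^-1))
    * ((1 - (t ^+ 2 * Q j * s)^-1) / (1 - (q * t * Q j * s)^-1))
    * ((1 - q * Q j * s / q ^+ n) / (1 - t * Q j * s / q ^+ n)).
Proof.
rewrite /shiraishi_term !argE !nek0_row // !nek0_11 //.
rewrite !nek1_row_11 // !nekN1_11_row // -addn2 -qfall_ratio2.
set x := (X in _ = _ * _ * (_ * X) * _ * _ * _).
set y := (X in _ = _ * X).
rewrite [RHS](_ : _ = (t / q) ^+ 2 * rfact n * (B * x
   * ((1 - q / (t * s)) / (1 - s^-1))
   * ((1 - (t ^+ 2 * Q j * s)^-1) / (1 - (q * t * Q j * s)^-1)) * y)); last by ring.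
rewrite -scaled_ratio1 {}/x {}/y.
have -> : q / t / q = t^-1 by rewrite mulrAC divff // mul1r.
have -> : q * (t^-1 / Q j) / t / q / s = (t ^+ 2 * Q j * s)^-1.
  by have := expf_neq0 j q_neq0; move: (Q j) => a a0; field; nz.
have -> : t^-1 / Q j / q / s = (q * t * Q j * s)^-1 by rewrite !invfM; ring.
have -> : q / t / s = q / (t * s) by rewrite invfM; ring.
rewrite [q ^+ j.+1]exprS [t * (q * _)]mulrCA ?mulr1 ?mul1r !invfM; ring.
Qed.

End Coefficients.

Arguments rfact : simpl never.

(** * The rational function identity behind the coefficient of p *)

Section Identity.
Variable F : fieldType.
(** [N] and [Q] stand for [q ^ n] and [q ^ j], and everything is divided by
    [rfact n * rfact (j + 2 - n) / rfact j]: [f1], [f2] and [g1], [g2] are the effect of lowering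
    [n] and [j + 2 - n] by 1 or 2, [J1], [J2] that of raising [j]. On the left, the first and third
    summands share the pole [s = N / q], the second and fourth the pole [s = N / (q * t * Q)]. These
    poles, which depend on [n], cancel in pairs, and only the three weights on the right remain. *)
Lemma order1_identity (q t s Q N : F) :
  [/\ q != 0, t != 0, s != 0, Q != 0 & N != 0] ->
  [/\ N - t * Q != 0, N - t * (Q * q) != 0, q * q - t * N != 0, q - t * N != 0 & q - t * Q != 0] ->
  [/\ 1 - t * Q != 0, t * Q - q * s != 0, 1 - t * (q * Q) != 0, 1 - s != 0 & 1 - q * (q * Q) != 0] ->
  [/\ 1 - q * Q != 0, 1 - t * q * Q * s != 0, 1 - q != 0, N - t * Q * s * q != 0 &
      q * t * Q * s - N != 0] -> N - s * q != 0 ->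
  let B := (1 - t^-1) / (1 - q^-1) in
  let f1 := (1 - N) / (1 - t * (N / q)) in
  let f2 := f1 * ((1 - N / q) / (1 - t * (N / q / q))) in
  let g1 := (1 - Q * q * q / N) / (1 - t * (Q * q / N)) in
  let g2 := g1 * ((1 - Q * q / N) / (1 - t * (Q / N))) in
  let J1 := (1 - t * Q) / (1 - q * Q) in
  let J2 := J1 * ((1 - t * (q * Q)) / (1 - q * (q * Q))) in
    (t / q) ^+ 2 * B * (f1 * g2)
    * ((1 - N / (t * s)) / (1 - N / (q * s)))
    * ((1 - q / (t ^+ 2 * Q)) / (1 - (t * Q)^-1))
   + (t / q) * B * (g1 / J1)
    * ((1 - N / (t ^+ 2 * Q * s)) / (1 - N / (q * t * Q * s)))
   + (t / q) ^+ 3 * B * (f2 * g1)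
    * ((1 - q ^+ 2 * s / (t * N)) / (1 - s * q / N))
    * ((1 - q / (t * s)) / (1 - s^-1))
    * ((1 - q / (t ^+ 2 * Q)) / (1 - (t * Q)^-1))
    * ((1 - Q / s) / (1 - t * Q / (q * s)))
   + (t / q) ^+ 2 * B * (f1 / J1)
    * ((1 - q / (t * s)) / (1 - s^-1))
    * ((1 - (t ^+ 2 * Q * s)^-1) / (1 - (q * t * Q * s)^-1))
    * ((1 - q ^+ 2 * Q * s / N) / (1 - t * Q * s * q / N))
  = (q / t) * ((1 - t) / (1 - q)) *
    ((1 - t ^+ 2 * Q * s) / (1 - t * q * Q * s) / J2
     + (1 - s * t / q) / (1 - s) *
       ((1 - q * Q) * (1 - t ^+ 2 * Q) / ((1 - t * (q * Q)) * (1 - t * Q))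
        + (1 - Q) * (1 - t ^+ 2 * Q / q) / ((1 - t * Q) * (1 - t * Q / q))) * (f1 * g1)
     + (1 - s / Q) / (1 - q * s / (t * Q)) *
       ((1 - t ^+ 2 * Q / q) * (1 - t ^+ 2 * Q / q / q) / ((1 - t * Q) * (1 - t * Q / q)))
       * (f2 * g2)).
Proof.
move=> [q0 t0 s0 Q0 N0] [h1 h2 h3 h4 h5] [h6 h7 h8 h9 h10].
move=> [h11 h12 h13 h14 h15] h16 B f1 f2 g1 g2 J1 J2; rewrite /J2 /f2 /g2 /J1 /f1 /g1 /B.
have h17 : q * t * Q * s - 1 != 0 by rewrite -oppr_eq0 opprB [q * t]mulrC.
have h18 : q * s - N != 0 by rewrite -oppr_eq0 opprB [q * s]mulrC.
by field; nz.
Qed.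
End Identity.

(** * The coefficient of p as a combination of three Rogers polynomials *)

Section LevelOne.
Variables (F : fieldType) (q t s : F).
Hypothesis indep : mult_indep q t s.

Let q_neq0 : q != 0. Proof. by case: indep. Qed.
Let t_neq0 : t != 0. Proof. by case: indep. Qed.
Let s_neq0 : s != 0. Proof. by case: indep. Qed.

Local Notation rfact := (rfact q t).
Local Notation rogers := (rogers q t).
Local Notation pieri := (pieri q t).

Lemma monomial_sub_neq0 (a b c : int) (x y : F) :
  (a, b, c) != (0, 0, 0) -> x != 0 -> y / x = q ^ a * t ^ b * s ^ c -> x - y != 0.
Proof.
move=> abc x0 yE; apply: (neq0_of_div (d := x) (indep_neq1 indep abc)).
by rewrite -yE mulrBl divff.
Qed.

(* The weights of the three terms that make up the coefficient of [p]; [weightP],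
   [weight0] and [weightM] are the only places where [s] enters, and are 1 at [s = 0]. *)
Definition weightA : F := (q / t) * ((1 - t) / (1 - q)).
Definition weightP (j : nat) : F := (1 - t ^+ 2 * q ^+ j * s) / (1 - t * q * q ^+ j * s).
Definition weight0 : F := (1 - s * t / q) / (1 - s).
Definition weightM (j : nat) : F := (1 - s / q ^+ j) / (1 - q * s / (t * q ^+ j)).

(** Apart from the weights, the three coefficients are those of (x_1 + x_2)^2 M_j expanded by
    applying the Pieri rule twice; the shifts of [z] by 1 and 2 stand for multiplication by x_1 x_2
    and its square. *)
Definition level1_coef (j : nat) (z : int) : F :=
  weightA * (weightP j * rogers j.+2 z
             + weight0 * (pieri j.+1 + pieri j) * rogers j (z - 1)
             + weightM j * (pieri j * pieri j.-1) * rogers j.-2 (z - 2)).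

Lemma pieri0 : pieri 0 = 0.
Proof. by rewrite /pieri expr0 subrr !mul0r. Qed.

(** Makes the lowest term uniform in [j]. For [j < 2], where [j.-2] is truncated, the left side is
    killed by [pieri 0 = 0] and the right side because [n - 2] or [j - n] is negative. *)
Lemma pieri_rogers2 (j n : nat) :
  pieri j * pieri j.-1 * rogers j.-2 (n%:Z - 2) =
  ((1 - t ^+ 2 * q ^+ j / q) * (1 - t ^+ 2 * q ^+ j / q / q)
    / ((1 - t * q ^+ j) * (1 - t * q ^+ j / q)))
  * (rfact (n%:Z - 2) * rfact (j%:Z - n%:Z)) / rfact j.
Proof.
have [j2|] := ltnP j 2.
  have -> : pieri j * pieri j.-1 = 0.
    by case: j j2 => [|[|]] //= _; rewrite pieri0 ?mul0r ?mulr0.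
  rewrite mul0r; suff -> : rfact (n%:Z - 2) * rfact (j%:Z - n%:Z) = 0.
    by rewrite mulr0 mul0r.
  have [n2|n2] := ltnP n 2.
    by case: n n2 => [|[|]] //= _; rewrite mul0r.
  have -> : j%:Z - n%:Z = Negz (n - j).-1 by lia.
  by rewrite mulr0.
case: j => [|[|k]] //= _.
rewrite /rogers (_ : k%:Z - (n%:Z - 2) = k.+2%:Z - n%:Z); last by lia.
rewrite /pieri !rfactS !exprS.
have := one_sub_q indep k; have := one_sub_q indep k.+1; rewrite !exprS.
have := one_sub_tqn indep k; have := one_sub_tqn indep k.+1; have := one_sub_tqn indep k.+2.
rewrite !exprS; have := rfact_neq0 indep k.
move: (q ^+ k) (rfact k%:Z) (rfact _) (rfact _) => a b c d *; field; nz.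
Qed.

Ltac feed H :=
  match type of H with ?A -> _ =>
    let h := fresh in assert (h : A); [| specialize (H h); clear h] end.

Ltac mono_tac a b c :=
  apply: (@monomial_sub_neq0 a b c);
  [ by rewrite ?xpair_eqE ?andbF | by rewrite ?mulf_neq0 ?oner_neq0
  | rewrite ?expfzDr // ?exprN1 ?expr1z ?expr0z -?exprnN -?exprnP;
    by field; nz ].

Local Notation B := ((1 - t^-1) / (1 - q^-1)).

(** Four terms for every [n]: when [n] is 0 or 1 and a family of [level1 n] is missing, the matching
    [rfact (n - 1)] or [rfact (n - 2)] is 0. *)
Lemma level1_sum_terms (j n : nat) (N := q ^+ n) (Q := q ^+ j) :
  \sum_(lm <- level1 n) (t / q) ^+ n.+1 * shiraishi_term q t s j lm.1 lm.2
  = (t / q) ^+ 2 * B * (rfact (n%:Z - 1) * (rfact (j%:Z - n%:Z) / rfact j))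
    * ((1 - N / (t * s)) / (1 - N / (q * s)))
    * ((1 - q / (t ^+ 2 * Q)) / (1 - (t * Q)^-1))
   + (t / q) * B * (rfact n * (rfact (j.+1%:Z - n%:Z) / rfact j.+1))
    * ((1 - N / (t ^+ 2 * Q * s)) / (1 - N / (q * t * Q * s)))
   + (t / q) ^+ 3 * B * (rfact (n%:Z - 2) * (rfact (j.+1%:Z - n%:Z) / rfact j))
    * ((1 - q ^+ 2 * s / (t * N)) / (1 - s * q / N))
    * ((1 - q / (t * s)) / (1 - s^-1))
    * ((1 - q / (t ^+ 2 * Q)) / (1 - (t * Q)^-1))
    * ((1 - Q / s) / (1 - t * Q / (q * s)))
   + (t / q) ^+ 2 * B * (rfact (n%:Z - 1) * (rfact (j.+2%:Z - n%:Z) / rfact j.+1))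
    * ((1 - q / (t * s)) / (1 - s^-1))
    * ((1 - (t ^+ 2 * Q * s)^-1) / (1 - (q * t * Q * s)^-1))
    * ((1 - q ^+ 2 * Q * s / N) / (1 - t * Q * s * q / N)).
Proof.
rewrite {}/N {}/Q /level1 big_cons /= shiraishi_row_1 //.
rewrite -2![RHS]addrA [RHS]addrCA; congr (_ + _).
case: n => [|m].
  rewrite big_nil (_ : rfact (0%:Z - 1) = 0) // (_ : rfact (0%:Z - 2) = 0) //.
  by rewrite ?(mulr0, mul0r, addr0).
rewrite !big_cons /= shiraishi_row1 // shiraishi_row_11 //.
have -> : m.+1%:Z - 1 = m by lia.
have qmE : q ^+ m = q ^+ m.+1 / q by rewrite exprS mulrC mulKf.
have e1 : q ^+ m / s = q ^+ m.+1 / (q * s) by rewrite qmE invfM; ring.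
have e2 : q * q ^+ j * s / q ^+ m = q ^+ 2 * q ^+ j * s / q ^+ m.+1.
  by rewrite qmE invfM invrK; ring.
have e3 : t * q ^+ j * s / q ^+ m = t * q ^+ j * s * q / q ^+ m.+1.
  by rewrite qmE invfM invrK; ring.
have e4 : (j.+1%:Z - m%:Z) = j.+2%:Z - m.+1%:Z by lia.
rewrite e1 e2 e3 e4; congr (_ + _); rewrite [RHS]addrC; congr (_ + _).
case: m qmE {e1 e2 e3 e4} => [|l] qmE; first by rewrite big_nil ?(mulr0, mul0r).
rewrite big_seq1 /= shiraishi_row11 //.
have -> : l.+2%:Z - 2 = l by lia.
have -> : j.+1%:Z - l.+2%:Z = j%:Z - l.+1%:Z by lia.
have -> : q * s / (t * q ^+ l.+1) = q ^+ 2 * s / (t * q ^+ l.+2).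
  by rewrite qmE !invfM invrK; ring.
have -> : s / q ^+ l.+1 = s * q / q ^+ l.+2 by rewrite qmE invfM invrK mulrA mulrAC.
by [].
Qed.

Lemma level1_sum (j n : nat) :
  \sum_(lm <- level1 n) (t / q) ^+ n.+1 * shiraishi_term q t s j lm.1 lm.2
  = level1_coef j n.
Proof.
rewrite level1_sum_terms.
have N0 : q ^+ n != 0 by rewrite expf_neq0.
have Q0 : q ^+ j != 0 by rewrite expf_neq0.
have tq : t * q != 0 by rewrite mulf_neq0.
have H := @order1_identity F q t s (q ^+ j) (q ^+ n) (And5 q_neq0 t_neq0 s_neq0 Q0 N0).
feed H.
  split.
  - by mono_tac (j%:Z - n%:Z) 1%:Z 0%:Z.
  - by mono_tac (j%:Z - n%:Z + 1) 1%:Z 0%:Z.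
  - by mono_tac (n%:Z - 1 - 1) 1%:Z 0%:Z.
  - by mono_tac (n%:Z - 1) 1%:Z 0%:Z.
  - by mono_tac (j%:Z - 1) 1%:Z 0%:Z.
feed H.
  split.
  - by mono_tac j%:Z 1%:Z 0%:Z.
  - by mono_tac (1 - j%:Z) (-1 : int) 1%:Z.
  - by mono_tac (1 + j%:Z) 1%:Z 0%:Z.
  - by mono_tac 0%:Z 0%:Z 1%:Z.
  - by rewrite -!exprS; exact: (one_sub_q indep).
feed H.
  split.
  - by rewrite -!exprS; exact: (one_sub_q indep).
  - by mono_tac (1 + j%:Z) 1%:Z 1%:Z.
  - exact: (one_sub_q indep 0).
  - by mono_tac (1 + j%:Z - n%:Z) 1%:Z 1%:Z.
  - by mono_tac (n%:Z - 1 - j%:Z) (-1 : int) (-1 : int).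
feed H.
  by mono_tac (1 - n%:Z) 0%:Z 1%:Z.
pose f1 := (1 - q ^+ n) / (1 - t * (q ^+ n / q)).
pose f2 := f1 * ((1 - q ^+ n / q) / (1 - t * (q ^+ n / q / q))).
pose g1 := (1 - q ^+ j * q * q / q ^+ n) / (1 - t * (q ^+ j * q / q ^+ n)).
pose g2 := g1 * ((1 - q ^+ j * q / q ^+ n) / (1 - t * (q ^+ j / q ^+ n))).
pose J1 := (1 - t * q ^+ j) / (1 - q * q ^+ j).
pose J2 := J1 * ((1 - t * (q * q ^+ j)) / (1 - q * (q * q ^+ j))).
cbv zeta in H; move: H; rewrite -/f1 -/g1 -/J1 -/f2 -/g2 -/J2 => H.
have F1 : rfact (n%:Z - 1) = rfact n * f1 by rewrite (rfact_pred indep) -[LHS]mulrA.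
have F2 : rfact (n%:Z - 2) = rfact n * f2.
  rewrite (_ : n%:Z - 2 = n%:Z - 1 - 1); last by lia.
  by rewrite (rfact_pred indep) F1 expfzDr // exprN1 -exprnP -2![LHS]mulrA.
have G1 : rfact (j.+1%:Z - n%:Z) = rfact (j.+2%:Z - n%:Z) * g1.
  rewrite (_ : j.+1%:Z - n%:Z = j.+2%:Z - n%:Z - 1); last by lia.
  rewrite (rfact_pred indep) expfzDr // -exprnN -exprnP 2!exprSr.
  rewrite -[LHS]mulrA; congr (_ * (_ / (1 - t * _))).
  by rewrite mulrAC mulfK.
have G2 : rfact (j%:Z - n%:Z) = rfact (j.+2%:Z - n%:Z) * g2.
  rewrite (_ : j%:Z - n%:Z = j.+1%:Z - n%:Z - 1); last by lia.
  rewrite (rfact_pred indep) G1 expfzDr // -exprnN -exprnP exprSr.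
  rewrite -2![LHS]mulrA; congr (_ * (_ * (_ / (1 - t * _)))).
  by rewrite mulrAC mulfK.
have J1E : rfact j.+1 = rfact j * J1 by rewrite rfactS exprS.
have J2E : rfact j.+2 = rfact j * J2 by rewrite rfactS J1E !exprS -[LHS]mulrA.
pose P := rfact n; pose G := rfact (j.+2%:Z - n%:Z); pose J := rfact j.
rewrite /level1_coef /weightA /weightP /weight0 /weightM.
have -> : rogers j.+2 n = P * G / J / J2 by rewrite /rogers J2E invfM mulrA.
have -> : rogers j (n%:Z - 1) = P * G / J * (f1 * g1).
  rewrite /rogers F1 (_ : j%:Z - (n%:Z - 1) = j.+1%:Z - n%:Z); last by lia.
  by rewrite G1 /P /G /J; ring.
have -> (x : F) : x * (pieri j * pieri j.-1) * rogers j.-2 (n%:Z - 2) =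
  P * G / J * (x * ((1 - t ^+ 2 * q ^+ j / q) * (1 - t ^+ 2 * q ^+ j / q / q)
    / ((1 - t * q ^+ j) * (1 - t * q ^+ j / q))) * (f2 * g2)).
  by rewrite -mulrA pieri_rogers2 F2 G2 /P /G /J; ring.
rewrite /pieri F1 F2 G1 G2 J1E -/P -/G -/J [q ^+ j.+1]exprS.
transitivity (P * G / J * (q / t * ((1 - t) / (1 - q)) *
    ((1 - t ^+ 2 * q ^+ j * s) / (1 - t * q * q ^+ j * s) / J2 +
     (1 - s * t / q) / (1 - s) *
     ((1 - q * q ^+ j) * (1 - t ^+ 2 * q ^+ j) /
      ((1 - t * (q * q ^+ j)) * (1 - t * q ^+ j)) +
      (1 - q ^+ j) * (1 - t ^+ 2 * q ^+ j / q) /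
      ((1 - t * q ^+ j) * (1 - t * q ^+ j / q))) *
     (f1 * g1) +
     (1 - s / q ^+ j) / (1 - q * s / (t * q ^+ j)) *
     ((1 - t ^+ 2 * q ^+ j / q) * (1 - t ^+ 2 * q ^+ j / q / q) /
      ((1 - t * q ^+ j) * (1 - t * q ^+ j / q))) *
     (f2 * g2)))).
  rewrite -H [(J * J1)^-1]invfM; ring.
have tE : t ^+ 2 * (q * q ^+ j) / q = t ^+ 2 * q ^+ j by rewrite mulrCA mulrC mulKf.
have tE' : t * (q * q ^+ j) / q = t * q ^+ j by rewrite mulrCA mulrC mulKf.
rewrite tE tE'.
ring.
Qed.

End LevelOne.

Section ShiraishiCoef.
Local Open Scope classical_set_scope.
Variables (F : fieldType) (q t s : F).
Hypothesis indep : mult_indep q t s.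

Lemma rfact_neg (z : int) : z < 0 -> rfact q t z = 0.
Proof. by case: z. Qed.

Lemma shiraishi_coef0 j (d : int) : shiraishi_coef q t s j 0 d = rogers q t j d.
Proof.
rewrite /shiraishi_coef; have [d0|d0] := leP 0 d; last first.
  rewrite fsbig1; first by rewrite /rogers rfact_neg // !mul0r.
  by move=> lm /level0P[_]; rewrite leNgt d0.
rewrite (_ : [set lm | _] = [set` [:: (row `|d|, [::])]]); last first.
  apply/seteqP; split=> lm /=; rewrite inE.
    by move/level0P => [-> _].
  by move=> /eqP lmE; apply/level0P.
rewrite -fsbig_seq //= big_seq1 /even_deg /odd_deg /= !weightE odd_weight_row even_weight_row.
by rewrite !addn0 add0n shiraishi_row // gez0_abs.
Qed.

Lemma shiraishi_coef1 j (d : int) :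
  shiraishi_coef q t s j 1 d = level1_coef q t s j (d + 1).
Proof.
rewrite /shiraishi_coef; have [d0|d0] := leP 0 (d + 1); last first.
  rewrite fsbig1; last by move=> lm /level1P[_]; rewrite leNgt d0.
  rewrite /level1_coef /rogers (@rfact_neg (d + 1)) // (@rfact_neg (d + 1 - 1)); last by lia.
  by rewrite (@rfact_neg (d + 1 - 2)) ?(mul0r, mulr0, addr0) //; lia.
rewrite (_ : [set lm | _] = [set` level1 `|d + 1|]); last first.
  apply/seteqP; split=> lm /=; first by move/level1P => [].
  by move=> lmE; apply/level1P.
rewrite -fsbig_seq ?level1_uniq //= -{2}(gez0_abs d0) -level1_sum //.
apply: eq_big_seq => lm lmE.
have /level1P[_ _ e o] : lm \in level1 `|d + 1| /\ 0 <= d + 1 by [].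
congr (_ ^+ _ * _); rewrite e add1n; congr S; lia.
Qed.

End ShiraishiCoef.

Local Notation "x %:F" := (FracField.tofrac x).

(** * Evaluation of fractions at a point *)

Section Value.
Variables (A : idomainType) (K : fieldType) (ev : {rmorphism A -> K}).
Implicit Types (f g : {fraction A}) (u v : K).

(** Being a relation, it is stable under the field operations as long as no value divided by is 0.
    Evaluating an explicit formula thus reduces to checking its denominators at the point, with no
    lowest terms involved. *)
Definition has_val f v : Prop :=
  exists n d : A, [/\ ev d != 0, f = n%:F / d%:F & v = ev n / ev d].

Lemma ev_den_neq0 (d : A) : ev d != 0 -> d%:F != 0.
Proof. by apply: contraNneq => /eqP; rewrite tofrac_eq0 => /eqP ->; rewrite rmorph0. Qed.

Lemma has_val_inj f u v : has_val f u -> has_val f v -> u = v.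
Proof.
move=> [n [d [d0 -> ->]]] [n' [d' [d'0 + ->]]] => /eqP.
rewrite eqr_div ?ev_den_neq0 // -!tofracM tofrac_eq => /eqP e.
by apply/eqP; rewrite eqr_div // -!rmorphM e.
Qed.

Lemma frac_valE f v : has_val f v -> frac_val ev f = v.
Proof.
move=> fv; rewrite /frac_val.
by apply: xget_unique => // u fu; apply: has_val_inj fu fv.
Qed.

Lemma has_val_tofrac (x : A) : has_val x%:F (ev x).
Proof. by exists x, 1; rewrite tofrac1 rmorph1 !divr1 oner_neq0. Qed.

Lemma has_val0 : has_val 0 0.
Proof. by rewrite -(tofrac0 A) -(rmorph0 ev); exact: has_val_tofrac. Qed.

Lemma has_val1 : has_val 1 1.
Proof. by rewrite -(tofrac1 A) -(rmorph1 ev); exact: has_val_tofrac. Qed.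

Lemma has_valD f g u v : has_val f u -> has_val g v -> has_val (f + g) (u + v).
Proof.
move=> [n [d [d0 -> ->]]] [n' [d' [d'0 -> ->]]].
exists (n * d' + n' * d), (d * d'); rewrite !rmorphM !rmorphD !rmorphM mulf_neq0 //.
by rewrite !addf_div ?ev_den_neq0.
Qed.

Lemma has_valN f u : has_val f u -> has_val (- f) (- u).
Proof. by move=> [n [d [d0 -> ->]]]; exists (- n), d; rewrite !rmorphN !mulNr. Qed.

Lemma has_valB f g u v : has_val f u -> has_val g v -> has_val (f - g) (u - v).
Proof. by move=> fu gv; apply: has_valD => //; apply: has_valN. Qed.

Lemma has_valM f g u v : has_val f u -> has_val g v -> has_val (f * g) (u * v).
Proof.
move=> [n [d [d0 -> ->]]] [n' [d' [d'0 -> ->]]].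
by exists (n * n'), (d * d'); rewrite !rmorphM mulf_neq0 // !mulf_div.
Qed.

Lemma has_valX f u n : has_val f u -> has_val (f ^+ n) (u ^+ n).
Proof.
move=> fu; elim: n => [|n IH]; first exact: has_val1.
by rewrite !exprS; apply: has_valM.
Qed.

Lemma has_valV f u : u != 0 -> has_val f u -> has_val f^-1 u^-1.
Proof.
move=> u0 [n [d [d0 -> uE]]]; exists d, n; rewrite uE !invf_div; split=> //.
by apply: contraNneq u0 => n0; rewrite uE n0 mul0r.
Qed.

Lemma has_val_div f g u v : v != 0 -> has_val f u -> has_val g v -> has_val (f / g) (u / v).
Proof. by move=> v0 fu gv; apply: has_valM => //; apply: has_valV. Qed.

Variables (q t s : {fraction A}) (q' t' s' : K).
Hypotheses (qv : has_val q q') (tv : has_val t t') (sv : has_val s s').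
Hypotheses (q0 : q' != 0) (t0 : t' != 0).
Hypotheses (qn : forall n : nat, 1 - q' ^+ n.+1 != 0).
Hypotheses (tqn : forall n : nat, 1 - t' * q' ^+ n != 0).

Lemma has_val_rfact z : has_val (rfact q t z) (rfact q' t' z).
Proof.
case: z => n; last exact: has_val0.
elim: n => [|n IH]; first by rewrite !rfact0; exact: has_val1.
rewrite !rfactS; apply: has_valM => //; apply: has_val_div => //.
  by apply: has_valB; [exact: has_val1|apply: has_valM => //; exact: has_valX].
by apply: has_valB; [exact: has_val1|exact: has_valX].
Qed.

Lemma rfact_val_neq0 (n : nat) : rfact q' t' n != 0.
Proof.
elim: n => [|n IH]; first by rewrite rfact0 oner_neq0.
by rewrite rfactS !mulf_neq0 ?invr_neq0.
Qed.

Lemma has_val_rogers j z : has_val (rogers q t j z) (rogers q' t' j z).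
Proof.
apply: has_val_div; rewrite ?rfact_val_neq0 //; last exact: has_val_rfact.
by apply: has_valM; exact: has_val_rfact.
Qed.

Ltac vals := repeat first
  [ assumption | exact: has_val1 | apply: has_val_div | apply: has_valB | apply: has_valD
  | apply: has_valM | apply: has_valX ].

(** The case [j = 0] is separate: there the denominator contains [1 - t' / q'], which is 0 when
    [beta = 1], but both sides are 0 by convention. *)
Lemma has_val_pieri j : has_val (pieri q t j) (pieri q' t' j).
Proof.
case: j => [|j]; first by rewrite !pieri0; exact: has_val0.
have qj : 1 - t' * q' ^+ j.+1 / q' != 0 by rewrite exprSr mulrA mulfK.
have D := mulf_neq0 (tqn j.+1) qj.
by rewrite /pieri; vals.
Qed.

Ltac vals' := repeat first
  [ assumption | exact: has_val1 | exact: has_val_rogers | exact: has_val_pieri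
  | apply: has_val_div | apply: has_valB | apply: has_valD
  | apply: has_valM | apply: has_valX ].

Hypothesis s1 : 1 - s' != 0.
Hypothesis sP : forall j : nat, 1 - t' * q' * q' ^+ j * s' != 0.
Hypothesis sM : forall j : nat, 1 - q' * s' / (t' * q' ^+ j) != 0.

Lemma has_val_level1 j z : has_val (level1_coef q t s j z) (level1_coef q' t' s' j z).
Proof.
have q1 : 1 - q' != 0 := qn 0.
have qj : q' ^+ j != 0 by rewrite expf_neq0.
have tqj : t' * q' ^+ j != 0 by rewrite mulf_neq0.
rewrite /level1_coef /weightA /weightP /weight0 /weightM.
by vals'.
Qed.

End Value.

(** * Multiplicative independence of indeterminates *)

Section Independence.

Lemma polyC_mulXn_inj (A : idomainType) (a b : A) m n :
  a != 0 -> b != 0 -> a%:P * 'X^m = b%:P * 'X^n -> m = n /\ a = b.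
Proof.
move=> a0 b0 e; have mn : m = n.
  have := congr1 (fun p : {poly A} => size p) e.
  by rewrite !size_mulXn ?polyC_eq0 // !size_polyC a0 b0 !addn1 => -[].
split=> //; have := congr1 (fun p : {poly A} => p`_n) e.
by rewrite /= mn !coefCM coefXn eqxx !mulr1.
Qed.

Lemma expz_split (K : fieldType) (x : K) (a : int) :
  x != 0 -> exists m n : nat, a = m%:Z - n%:Z /\ x ^ a = x ^+ m / x ^+ n.
Proof.
move=> x0; case: a => n; first by exists n, 0%N; rewrite subr0 expr0 divr1.
by exists 0%N, n.+1; rewrite NegzE sub0r expr0 mul1r.
Qed.

Lemma mult_indep_frac (L : fieldType) (u : L) (c : int) :
  u != 0 -> cst u * ('X%:F) ^ c = 1 -> c = 0 /\ u = 1.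
Proof.
move=> u0; have X0 : ('X : {poly L})%:F != 0 by rewrite tofrac_eq0 polyX_eq0.
have [m [n [-> ->]]] := expz_split c X0.
rewrite /cst mulrA => /(canRL (divfK (expf_neq0 n X0))).
rewrite -!tofracXn -!tofracM mul1r => /eqP; rewrite tofrac_eq => /eqP e.
have [|mn uE] := @polyC_mulXn_inj L u 1 m n u0 (oner_neq0 _); first by rewrite e mul1r.
by rewrite mn subrr.
Qed.

Variable K : fieldType.

Lemma cst_zM (L : fieldType) (a b : L) : cst (a * b) = cst a * cst b.
Proof. by rewrite /cst polyCM tofracM. Qed.

Lemma cst_neq0 (L : fieldType) (a : L) : a != 0 -> cst a != 0.
Proof. by move=> a0; rewrite tofrac_eq0 polyC_eq0. Qed.

Lemma cst1 (L : fieldType) : cst (1 : L) = 1.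
Proof. by rewrite /cst polyC1 tofrac1. Qed.

Lemma cstV (L : fieldType) (a : L) : cst a^-1 = (cst a)^-1.
Proof.
have [->|a0] := eqVneq a 0; first by rewrite invr0 /cst polyC0 tofrac0 invr0.
by apply: (mulfI (cst_neq0 a0)); rewrite -cst_zM !mulfV ?cst_neq0 ?cst1.
Qed.

Lemma cstX (L : fieldType) (a : L) n : cst (a ^+ n) = cst a ^+ n.
Proof. by rewrite /cst polyC_exp tofracXn. Qed.

Lemma cstXz (L : fieldType) (a : L) (n : int) : cst (a ^ n) = cst a ^ n.
Proof. by case: n => n; [exact: cstX | rewrite !NegzE -!exprnN cstV cstX]. Qed.

Lemma indep_qts : mult_indep (qvar3 K) (tvar3 K) (svar3 K).
Proof.
have q0 : qvar3 K != 0 by rewrite tofrac_eq0 !polyC_eq0 polyX_eq0.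
have t0 : tvar3 K != 0 by rewrite tofrac_eq0 !polyC_eq0 polyX_eq0.
have s0 : svar3 K != 0 by rewrite tofrac_eq0 polyX_eq0.
split; [exact: q0 | exact: t0 | exact: s0 | move=> a b c].
have [a1 [a2 [-> ->]]] := expz_split a q0.
have [b1 [b2 [-> ->]]] := expz_split b t0.
have [c1 [c2 [-> ->]]] := expz_split c s0.
rewrite !mulf_div => /divr1_eq.
rewrite -!tofracXn -!tofracM => /eqP; rewrite tofrac_eq -!polyC_exp -!polyCM => /eqP.
have nz (m n : nat) : (('X^m)%:P * 'X^n : {poly {poly K}}) != 0.
  by rewrite mulf_neq0 ?polyC_eq0 ?expf_neq0 ?polyX_eq0.
move/(polyC_mulXn_inj (nz _ _) (nz _ _)) => [->].
have nz1 (m : nat) : ('X ^+ m : {poly K}) != 0 by rewrite expf_neq0 ?polyX_eq0.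
move/(polyC_mulXn_inj (nz1 _) (nz1 _)) => [-> e].
have := @polyC_mulXn_inj K 1 1 a1 a2 (oner_neq0 _) (oner_neq0 _).
by rewrite !mul1r => /(_ e)[->]; rewrite !subrr.
Qed.

Lemma indep_qt : [/\ qvar2 K != 0, tvar2 K != 0 &
  forall a b : int, qvar2 K ^ a * tvar2 K ^ b = 1 -> a = 0 /\ b = 0].
Proof.
have q0 : qvar2 K != 0 by rewrite tofrac_eq0 !polyC_eq0 polyX_eq0.
have t0 : tvar2 K != 0 by rewrite tofrac_eq0 polyX_eq0.
split; [exact: q0 | exact: t0 | move=> a b].
have [a1 [a2 [-> ->]]] := expz_split a q0.
have [b1 [b2 [-> ->]]] := expz_split b t0.
rewrite !mulf_div => /divr1_eq.
rewrite -!tofracXn -!tofracM => /eqP; rewrite tofrac_eq -!polyC_exp => /eqP.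
have nz1 (m : nat) : ('X ^+ m : {poly K}) != 0 by rewrite expf_neq0 ?polyX_eq0.
move/(polyC_mulXn_inj (nz1 _) (nz1 _)) => [-> e].
have := @polyC_mulXn_inj K 1 1 a1 a2 (oner_neq0 _) (oner_neq0 _).
by rewrite !mul1r => /(_ e)[->]; rewrite !subrr.
Qed.

(** Comparing powers of ['X] gives [c = 0] at once, so independence over the constants is required
    only for that [c]. With [u = 1] this serves the value at [s = 0], with [u] the inverse of [s]
    the substitution of [p / s]. *)
Lemma indep_cst (L : fieldType) (q t u : L) : q != 0 -> t != 0 -> u != 0 ->
  (forall a b c : int, q ^ a * t ^ b * u ^ c = 1 -> c = 0 -> a = 0 /\ b = 0) ->
  mult_indep (cst q) (cst t) ('X%:F * cst u).
Proof.
move=> q0 t0 u0 H.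
have X0 : ('X : {poly L})%:F != 0 by rewrite tofrac_eq0 polyX_eq0.
split; [exact: cst_neq0 | exact: cst_neq0 | exact: mulf_neq0 X0 (cst_neq0 u0) | move=> a b c].
have -> : cst q ^ a * cst t ^ b * ('X%:F * cst u) ^ c = cst (q ^ a * t ^ b * u ^ c) * 'X%:F ^ c.
  rewrite !cst_zM !cstXz -[RHS]mulrA; congr (_ * _); rewrite [RHS]mulrC.
  by apply: exprzMl; rewrite unitfE; [exact: X0|exact: cst_neq0].
have n0 : q ^ a * t ^ b * u ^ c != 0 by rewrite !mulf_neq0 ?expfz_neq0.
by move=> /(mult_indep_frac n0)[c0 /H/(_ c0)[]].
Qed.

End Independence.

(** * Expansion of fractions at p = 0 *)

Section FracCoef.
Variable L : fieldType.

Lemma coefM1 (p q : {poly L}) : (p * q)`_1 = p`_0 * q`_1 + p`_1 * q`_0.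
Proof. by rewrite coefM !big_ord_recl big_ord0 addr0. Qed.

Lemma coefM0 (p q : {poly L}) : (p * q)`_0 = p`_0 * q`_0.
Proof. by rewrite coefM big_ord1. Qed.

Lemma sdiv0 (f g : nat -> L) : sdiv f g 0 = f 0%N / g 0%N.
Proof. by rewrite /sdiv /= big_ord0 subr0. Qed.

Lemma sdiv1 (f g : nat -> L) :
  sdiv f g 1 = (f 1%N - f 0%N / g 0%N * g 1%N) / g 0%N.
Proof. by rewrite /sdiv /= big_ord1 big_ord0 subr0. Qed.

Definition ev0 : {rmorphism {poly L} -> L} := horner_eval (0 : L).

Lemma ev0E (p : {poly L}) : ev0 p = p`_0.
Proof. exact: horner_coef0. Qed.

Lemma has_val_X0 : has_val ev0 'X%:F 0.
Proof. have := has_val_tofrac ev0 'X; by rewrite ev0E coefX. Qed.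

Lemma has_val_cst (x : L) : has_val ev0 (cst x) x.
Proof. have := has_val_tofrac ev0 x%:P; by rewrite ev0E coefC. Qed.

Lemma frac_coef0 f v : has_val ev0 f v -> frac_coef f 0 = v.
Proof.
move=> fv; rewrite /frac_coef; apply: xget_unique => [|u [n [d [d0 fE ->]]]].
  case: fv => n [d [d0 fE vE]]; exists n, d.
  by rewrite sdiv0 -!ev0E.
rewrite sdiv0 -!ev0E; apply: has_val_inj fv.
by exists n, d; split=> //; rewrite ev0E.
Qed.

(** The constant term [c] does not involve p, so the coefficient of p is just the value of [g] at 0.
    This is the situation of P_i at [p / s], whose term of order 0 is free of [s]. *)
Lemma frac_coef1 (c : L) (g : {fraction {poly L}}) v :
  has_val ev0 g v -> frac_coef (cst c + 'X%:F * g) 1 = v.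
Proof.
move=> gv; rewrite /frac_coef; apply: xget_unique => [|u [n [d [d0 fE ->]]]].
  case: gv => n [d [d0 -> ->]]; exists (c%:P * d + 'X * n), d.
  rewrite ev0E in d0; split=> //.
    rewrite tofracD !tofracM mulrDl mulfK ?mulrA //.
    by apply: (@ev_den_neq0 _ _ ev0); rewrite ev0E.
  rewrite sdiv1 !ev0E !coefD !coefCM !coefXM /= addr0 mulfK // addrC addKr //.
case: gv => n' [d' [d'0 gE ->]].
have : (c%:P * d' + 'X * n') * d = n * d'.
  apply/eqP; rewrite -tofrac_eq !tofracM tofracD !tofracM -(eqr_div _ _) -?fE ?gE.
  - by rewrite mulrDl mulfK ?mulrA // (@ev_den_neq0 _ _ ev0).
  - by rewrite (@ev_den_neq0 _ _ ev0).
  - by rewrite (@ev_den_neq0 _ _ ev0) // ev0E.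
rewrite !ev0E in d'0 *.
move=> /(congr1 (fun p : {poly L} => (p`_0, p`_1))).
rewrite !(coefM1, coefM0) !coefD !coefCM !coefXM /= addr0 => -[e0 e1].
have n0E : n`_0 = c * d`_0.
  by apply: (mulIf d'0); rewrite -e0 mulrAC.
rewrite sdiv1; apply/eqP; rewrite eqr_div // n0E mulfK //; apply/eqP.
rewrite mulrBl -[n`_1 * _](addKr (n`_0 * d'`_1)) -e1 n0E.
ring.
Qed.

End FracCoef.

Lemma has_val_level1_at0 (A : idomainType) (K : fieldType) (ev : {rmorphism A -> K})
    (q t s : {fraction A}) (q' t' : K) j z :
  has_val ev q q' -> has_val ev t t' -> has_val ev s 0 -> q' != 0 -> t' != 0 ->
  (forall n : nat, 1 - q' ^+ n.+1 != 0) -> (forall n : nat, 1 - t' * q' ^+ n != 0) ->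
  has_val ev (level1_coef q t s j z) (level1_coef q' t' 0 j z).
Proof.
move=> qv tv sv q0 t0 qn tqn; apply: (has_val_level1 qv tv sv) => //= *;
  by rewrite ?(mulr0, mul0r) subr0 oner_neq0.
Qed.

Lemma rfact_rmorph (F G : fieldType) (f : {rmorphism F -> G}) (x y : F) z :
  rfact (f x) (f y) z = f (rfact x y z).
Proof.
case: z => n; last by rewrite /rfact rmorph0.
rewrite /rfact rmorph_prod; apply: eq_bigr => i _.
by rewrite fmorph_div !rmorphB !rmorph1 rmorphM !rmorphXn.
Qed.

Lemma rogers_cst (L : fieldType) (x y : L) j d :
  rogers (cst x) (cst y) j d = cst (rogers x y j d).
Proof.
pose f : {rmorphism L -> {fraction {poly L}}} := (@FracField.tofrac {poly L}) \o polyC.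
by rewrite /rogers -[cst x]/(f x) -[cst y]/(f y) !rfact_rmorph -rmorphM -fmorph_div.
Qed.

(** * Numerical values of the coefficients of order 0 and 1 *)

Section CoefValues.
Variables (K : fieldType) (q t s : K).

Definition morph_qt : {rmorphism {poly {poly K}} -> K} :=
  horner_eval q \o horner_eval t%:P.

Definition morph_qts : {rmorphism {poly {poly {poly K}}} -> K} :=
  morph_qt \o horner_eval s%:P%:P.

Lemma morph_qtsE : ev_qts q t s = morph_qts.
Proof. by []. Qed.

Lemma morph_qtE : ev_qt q t = morph_qt.
Proof. by []. Qed.

Hypotheses (q0 : q != 0) (t0 : t != 0).
Hypotheses (qn : forall n : nat, 1 - q ^+ n.+1 != 0).
Hypotheses (tqn : forall n : nat, 1 - t * q ^+ n != 0).

Lemma qvar3_val : has_val morph_qts (qvar3 K) q.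
Proof.
have := has_val_tofrac morph_qts 'X%:P%:P.
by rewrite -morph_qtsE /ev_qts /ev_qt !hornerC hornerX.
Qed.

Lemma tvar3_val : has_val morph_qts (tvar3 K) t.
Proof.
have := has_val_tofrac morph_qts 'X%:P.
by rewrite -morph_qtsE /ev_qts /ev_qt !hornerC hornerX hornerC.
Qed.

Lemma svar3_val : has_val morph_qts (svar3 K) s.
Proof.
have := has_val_tofrac morph_qts 'X.
by rewrite -morph_qtsE /ev_qts /ev_qt hornerX !hornerC.
Qed.

Lemma qvar2_val : has_val morph_qt (qvar2 K) q.
Proof.
have := has_val_tofrac morph_qt 'X%:P.
by rewrite -morph_qtE /ev_qt !hornerC hornerX.
Qed.

Lemma tvar2_val : has_val morph_qt (tvar2 K) t.
Proof.
have := has_val_tofrac morph_qt 'X.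
by rewrite -morph_qtE /ev_qt hornerX hornerC.
Qed.

Lemma coef_s0 j d : coef_s q t s j 0 d = rogers q t j d.
Proof.
rewrite /coef_s (shiraishi_coef0 (indep_qts K)) morph_qtsE; apply: frac_valE.
by apply: has_val_rogers => //; [exact: qvar3_val|exact: tvar3_val].
Qed.

Lemma coef_s1 j d :
  1 - s != 0 -> (forall j : nat, 1 - t * q * q ^+ j * s != 0) ->
  (forall j : nat, 1 - q * s / (t * q ^+ j) != 0) ->
  coef_s q t s j 1 d = level1_coef q t s j (d + 1).
Proof.
move=> s1 sP sM.
rewrite /coef_s (shiraishi_coef1 (indep_qts K)) morph_qtsE; apply: frac_valE.
by apply: has_val_level1 => //; [exact: qvar3_val|exact: tvar3_val|exact: svar3_val].
Qed.

Lemma neq1_of_indep (L : fieldType) (x y : L) :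
  (forall a b : int, x ^ a * y ^ b = 1 -> a = 0 /\ b = 0) ->
  (forall n : nat, 1 - x ^+ n.+1 != 0) /\ (forall n : nat, 1 - y * x ^+ n != 0).
Proof.
move=> H; split=> n; rewrite subr_eq0 eq_sym; apply/eqP => e.
  by have [] := H n.+1 0; rewrite ?expr0z ?mulr1.
by have [] := H n 1; rewrite ?expr1z ?[_ * y]mulrC.
Qed.

Lemma indep_cst_qt : mult_indep (cst (qvar2 K)) (cst (tvar2 K)) 'X%:F.
Proof.
have [q2 t2 H] := indep_qt K.
have := indep_cst q2 t2 (oner_neq0 _); rewrite cst1 mulr1; apply.
by move=> a b c; rewrite exp1rz mulr1 => /H.
Qed.

Lemma indep_cst_qts : mult_indep (cst (qvar3 K)) (cst (tvar3 K)) ('X%:F / cst (svar3 K)).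
Proof.
have [q3 t3 s3 H] := indep_qts K; rewrite -cstV.
apply: (indep_cst q3 t3); first by rewrite invr_eq0.
by move=> a b c; rewrite exprz_inv => /H [-> -> _] _.
Qed.

Lemma qt2_neq1 : [/\ qvar2 K != 0, tvar2 K != 0,
  (forall n : nat, 1 - qvar2 K ^+ n.+1 != 0) & (forall n : nat, 1 - tvar2 K * qvar2 K ^+ n != 0)].
Proof.
have [q2 t2 H] := indep_qt K; have [a b] := neq1_of_indep H.
exact: (And4 q2 t2 a b).
Qed.

Lemma qt3_neq1 : [/\ qvar3 K != 0, tvar3 K != 0,
  (forall n : nat, 1 - qvar3 K ^+ n.+1 != 0) & (forall n : nat, 1 - tvar3 K * qvar3 K ^+ n != 0)].
Proof.
have i := indep_qts K; case: (i) => q3 t3 _ _; split; [exact: q3 | exact: t3 | |].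
  exact: one_sub_q i.
exact: one_sub_tqn i.
Qed.

Lemma coef_00 j d : coef_0 q t j 0 d = rogers q t j d.
Proof.
have [q2 t2 qn2 tqn2] := qt2_neq1.
rewrite /coef_0 (shiraishi_coef0 indep_cst_qt) morph_qtE.
rewrite (_ : frac_val _ _ = rogers (qvar2 K) (tvar2 K) j d).
  by apply: frac_valE; exact: (has_val_rogers qvar2_val tvar2_val).
apply: (@frac_valE _ _ (ev0 _)).
exact: (has_val_rogers (has_val_cst _) (has_val_cst _) qn2 tqn2).
Qed.

Lemma coef_01 j d : coef_0 q t j 1 d = level1_coef q t 0 j (d + 1).
Proof.
have [q2 t2 qn2 tqn2] := qt2_neq1.
rewrite /coef_0 (shiraishi_coef1 indep_cst_qt) morph_qtE.
have qt_val j' := has_val_level1_at0 j' (d + 1) qvar2_val tvar2_val (has_val0 _) q0 t0 qn tqn.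
rewrite (_ : frac_val _ _ = level1_coef (qvar2 K) (tvar2 K) 0 j (d + 1)).
  by apply: frac_valE; exact: qt_val.
apply: (@frac_valE _ _ (ev0 _)).
exact: (has_val_level1_at0 _ _ (has_val_cst _) (has_val_cst _) (has_val_X0 _) q2 t2 qn2 tqn2).
Qed.

Lemma coef_ps0 j d : coef_ps q t s j 0 d = rogers q t j d.
Proof.
have [q2 t2 qn2 tqn2] := qt3_neq1.
rewrite /coef_ps big_ord1 expr0 mul1r (shiraishi_coef0 indep_cst_qts) morph_qtsE.
rewrite (_ : frac_coef _ _ = rogers (qvar3 K) (tvar3 K) j d).
  by apply: frac_valE; exact: (has_val_rogers qvar3_val tvar3_val).
apply: frac_coef0.
exact: (has_val_rogers (has_val_cst _) (has_val_cst _) qn2 tqn2).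
Qed.

(** The third parameter [p / s] tends to 0 with p, hence the value at [s = 0]. The shift to [d + 1]
    is the odd degree, which is [k + d] at order [k = 1]. *)
Lemma coef_ps1 j d : coef_ps q t s j 1 d = level1_coef q t 0 j (d + 1).
Proof.
have [q2 t2 qn2 tqn2] := qt3_neq1.
rewrite /coef_ps big_ord_recl big_ord1 expr0 mul1r expr1 morph_qtsE.
rewrite (shiraishi_coef0 indep_cst_qts) (shiraishi_coef1 indep_cst_qts) rogers_cst.
rewrite (@frac_coef1 _ _ _ (level1_coef (qvar3 K) (tvar3 K) 0 j (d + 1))).
  apply: frac_valE.
  exact: (has_val_level1_at0 _ _ qvar3_val tvar3_val (has_val0 _) q0 t0 qn tqn).
apply: (has_val_level1_at0 _ _ (has_val_cst _) (has_val_cst _) _ q2 t2 qn2 tqn2).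
rewrite -cstV -(mul0r (svar3 K)^-1); exact: has_valM (has_val_X0 _) (has_val_cst _).
Qed.
End CoefValues.

(** * The Pieri rule for coefficients, with indeterminate parameters *)

Section PieriGeneric.
Variables (F : fieldType) (q t s : F).
Hypothesis indep : mult_indep q t s.

Let q_neq0 : q != 0. Proof. by case: indep. Qed.
Let t_neq0 : t != 0. Proof. by case: indep. Qed.

Local Notation rfact := (rfact q t).
Local Notation rogers := (rogers q t).
Local Notation pieri := (pieri q t).

Lemma pieri_rogers1 (j n : nat) :
  pieri j * rogers j.-1 (n%:Z - 1) =
  (1 - t ^+ 2 * q ^+ j / q) / (1 - t * q ^+ j)
  * (rfact (n%:Z - 1) * rfact (j%:Z - n%:Z)) / rfact j.
Proof.
case: j => [|k].
  rewrite pieri0 mul0r; suff -> : rfact (n%:Z - 1) * rfact (0%N%:Z - n%:Z) = 0.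
    by rewrite mulr0 mul0r.
  by case: n => [|n] //=; rewrite ?mul0r // (_ : 0%N%:Z - n.+1%:Z = Negz n) ?mulr0 // NegzE sub0r.
rewrite /rogers /= (_ : k%:Z - (n%:Z - 1) = k.+1%:Z - n%:Z); last by lia.
rewrite /pieri !rfactS !exprS.
have := one_sub_q indep k; rewrite exprS.
have := one_sub_tqn indep k; have := one_sub_tqn indep k.+1.
rewrite !exprS; have := rfact_neq0 indep k.
by move: (q ^+ k) (rfact k%:Z) (rfact _) (rfact _) => a b c d *; field; nz.
Qed.

Lemma rogers_rec_indep (j n : nat) :
  rogers j.+1 n = rogers j n + rogers j (n%:Z - 1) - pieri j * rogers j.-1 (n%:Z - 1).
Proof.
rewrite pieri_rogers1 /rogers.
rewrite (_ : j%:Z - (n%:Z - 1) = j.+1%:Z - n%:Z); last by lia.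
rewrite (_ : j%:Z - n%:Z = j.+1%:Z - n%:Z - 1); last by lia.
rewrite !(rfact_pred indep) rfactS.
have := rfact_neq0 indep j; have := one_sub_q indep j; have := one_sub_tqn indep j.
have := one_sub_tq indep (n%:Z - 1); have := one_sub_tq indep (j%:Z - n%:Z).
have -> : j.+1%:Z - n%:Z = 1 + j%:Z - n%:Z by lia.
rewrite !expfzDr // ?expr1z ?exprN1 -!exprnN -!exprnP ?expr1 exprS.
have := expf_neq0 n q_neq0; have := expf_neq0 j q_neq0.
move: (q ^+ n) (q ^+ j) (rfact j) (rfact _) (rfact _) => a b c d e b0 a0 h1 h2 h3 h4 c0.
have h1' : a - t * b != 0 by apply: (neq0_of_div (d := a) h1); field; nz.
have h2' : q - t * a != 0 by apply: (neq0_of_div (d := q) h2); field; nz.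
by field; nz.
Qed.

End PieriGeneric.

(** * Type A_1 Macdonald polynomials at numerical parameters *)

Section Macdonald.
Variables (K : fieldType) (q t : K).
Hypotheses (q0 : q != 0) (t0 : t != 0).
Hypotheses (qn : forall n : nat, 1 - q ^+ n.+1 != 0).
Hypotheses (tqn : forall n : nat, 1 - t * q ^+ n != 0).

Local Notation rogers := (rogers q t).
Local Notation pieri := (pieri q t).

(* The factors [1 - t q ^ z] with [z < 0] may vanish at the given numbers, so the
   identity is proved for indeterminates and then specialized. *)
Lemma rogers_rec (j n : nat) :
  rogers j.+1 n = rogers j n + rogers j (n%:Z - 1) - pieri j * rogers j.-1 (n%:Z - 1).
Proof.
(* The third indeterminate does not occur in the identity; 1 is an arbitrary value for it. *)
have r k z := has_val_rogers (qvar3_val q t 1) (tvar3_val q t 1) qn tqn k z.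
have p k := has_val_pieri (qvar3_val q t 1) (tvar3_val q t 1) q0 tqn k.
apply: (has_val_inj (r j.+1 n)); rewrite (rogers_rec_indep (indep_qts K)).
by apply: has_valB (has_valD (r _ _) (r _ _)) (has_valM (p _) (r _ _)).
Qed.

(** The Pieri rule is taken as definition, since the later inductions use only this recursion;
    [rgen_mac] identifies the result with the explicit coefficients. *)
Fixpoint mac (j : nat) (x1 x2 : K) : K :=
  if j is i.+1 then
    (x1 + x2) * mac i x1 x2
    - pieri i * (x1 * x2) * (if i is i'.+1 then mac i' x1 x2 else 0)
  else 1.

Lemma macS j x1 x2 :
  mac j.+1 x1 x2 = (x1 + x2) * mac j x1 x2 - pieri j * (x1 * x2) * mac j.-1 x1 x2.
Proof. by case: j => [|j] //=; rewrite pieri0 !mul0r. Qed.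

Lemma rogers_neg j z : z < 0 -> rogers j z = 0.
Proof. by move=> z0; rewrite /rogers rfact_neg // !mul0r. Qed.

Lemma rogers_big (j : nat) (z : int) : j%:Z < z -> rogers j z = 0.
Proof. by move=> jz; rewrite /rogers (@rfact_neg _ _ _ (j%:Z - z)) ?mulr0 ?mul0r // subr_lt0. Qed.

Definition rgen (j : nat) (r : K) : K := \sum_(n < j.+1) rogers j n * r ^+ n.

Lemma rgen_shift (j k N : nat) r : (j + k < N)%N ->
  \sum_(n < N) rogers j (n%:Z - k%:Z) * r ^+ n = r ^+ k * rgen j r.
Proof.
elim: k N => [|k IH] [|N] //= jN.
  rewrite expr0 mul1r /rgen; rewrite addn0 in jN.
  rewrite (big_ord_widen N.+1 (fun n => rogers j n%:Z * r ^+ n)) //.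
  rewrite [RHS]big_mkcond; apply: eq_bigr => i _; rewrite subr0.
  by case: ltnP => // ij; rewrite rogers_big ?mul0r.
rewrite big_ord_recl rogers_neg ?mul0r ?add0r //.
rewrite exprS -mulrA -(IH N) ?mulr_sumr; last by rewrite addnS in jN.
apply: eq_bigr => i _; rewrite lift0 exprS (_ : i.+1%:Z - k.+1%:Z = i%:Z - k%:Z); last by lia.
by rewrite mulrCA.
Qed.

Lemma rgenS j r : rgen j.+1 r = (1 + r) * rgen j r - pieri j * r * rgen j.-1 r.
Proof.
rewrite /rgen (eq_bigr (fun n : 'I_j.+2 => rogers j (n%:Z - 0%N%:Z) * r ^+ n
  + rogers j (n%:Z - 1%N%:Z) * r ^+ n - pieri j * (rogers j.-1 (n%:Z - 1%N%:Z) * r ^+ n))).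
  rewrite big_split /= sumrN big_split /= -mulr_sumr !rgen_shift; try lia.
  by rewrite expr0 expr1 -!/(rgen _ r); ring.
by move=> i _; rewrite rogers_rec subr0; ring.
Qed.

Lemma rgen_mac j x1 x2 : x1 != 0 -> x1 ^+ j * rgen j (x2 / x1) = mac j x1 x2.
Proof.
move=> x10; elim/ltn_ind: j => -[|j] IH.
  by rewrite /rgen big_ord1 /rogers subr0 rfact0 divr1 !mul1r.
rewrite rgenS macS -IH // -IH; last by case: (j).
case: j {IH} => [|j]; first by rewrite pieri0 expr1; field; nz.
by rewrite /= !exprS; field; nz.
Qed.

Lemma mac_sym j x1 x2 : mac j x1 x2 = mac j x2 x1.
Proof.
elim/ltn_ind: j => -[|j] IH //.
by rewrite !macS IH // IH ?[x1 + x2]addrC ?[x1 * x2]mulrC //; case: (j).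
Qed.

Lemma mac_scale j c x1 x2 : mac j (c * x1) (c * x2) = c ^+ j * mac j x1 x2.
Proof.
elim/ltn_ind: j => -[|[|j]] IH; rewrite ?mul1r //.
  by rewrite !macS /= pieri0; ring.
by rewrite [LHS]macS [mac j.+2 x1 x2]macS IH // IH // !exprS; ring.
Qed.

End Macdonald.

Arguments mac : simpl never.

(** * Shift relations, eigenvalue equation and raising relation *)

Section MacdonaldShift.
Variables (K : fieldType) (q t : K).
Hypotheses (q0 : q != 0) (t0 : t != 0).
Hypotheses (qn : forall n : nat, 1 - q ^+ n.+1 != 0).
Hypotheses (tqn : forall n : nat, 1 - t * q ^+ n != 0).

Local Notation rogers := (rogers q t).
Local Notation pieri := (pieri q t).
Local Notation mac := (mac q t).
Local Notation rgen := (rgen q t).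

(** A single shift, cleared of the denominator of the Macdonald operator, already closes on M_j and
    M_(j-1). Combined with its mirror image it yields both the eigenvalue equation and the raising
    relation. *)
Lemma mac_shift2 j x1 x2 :
  (x1 - t * x2) * mac j x1 (q * x2) =
  (x1 - t * q ^+ j * x2) * mac j x1 x2
  - (1 - t * q ^+ j) * pieri j * (x1 * x2) * mac j.-1 x1 x2.
Proof.
elim/ltn_ind: j => -[|[|j]] IH.
- by rewrite pieri0 expr0 /mac; ring.
- have := tqn 0; have := tqn 1; rewrite /mac pieri0 /pieri expr0 expr1 !mulr1 => h1 h0.
  have -> : t * q / q = t by rewrite mulfK.
  have -> : t ^+ 2 * q / q = t ^+ 2 by rewrite mulfK.
  by field; nz.
have E : pieri j.+1 * (x1 * x2) * mac j x1 x2 = (x1 + x2) * mac j.+1 x1 x2 - mac j.+2 x1 x2.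
  by rewrite (macS _ _ j.+1) /=; ring.
have E0 := IH j.+1 (ltnSn _); have E1 := IH j (leqnSn _).
rewrite (macS _ _ j.+1) mulrBr mulrCA E0 /=.
have -> : (x1 - t * x2) * (pieri j.+1 * (x1 * (q * x2)) * mac j x1 (q * x2)) =
   pieri j.+1 * (x1 * (q * x2)) * ((x1 - t * x2) * mac j x1 (q * x2)) by ring.
rewrite E1.
(* M_(j-1) is eliminated so that both sides involve only M_j and M_(j+1), whose coefficients then
   agree as rational functions. *)
have E2 : pieri j * (x1 * x2) * mac j.-1 x1 x2 = (x1 + x2) * mac j x1 x2 - mac j.+1 x1 x2.
  by rewrite (macS _ _ j) /=; ring.
have -> (y : K) : y * pieri j * (x1 * x2) * mac j.-1 x1 x2 =
   y * ((x1 + x2) * mac j x1 x2 - mac j.+1 x1 x2) by rewrite -E2; ring.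
rewrite (macS _ _ j.+1) /=.
rewrite /pieri [q ^+ j.+2]exprS [q ^+ j.+1]exprS.
have := tqn j; have := tqn j.+1; have := tqn j.+2.
rewrite [q ^+ j.+2]exprS [q ^+ j.+1]exprS.
move: (mac _ _ _) (mac _ _ _) (q ^+ j) => m1 m2 Q h2 h1 h0.
have -> : t * (q * Q) / q = t * Q by rewrite mulrCA mulrC mulKf.
have -> : t ^+ 2 * (q * Q) / q = t ^+ 2 * Q by rewrite mulrCA mulrC mulKf.
have -> : t * (q * (q * Q)) / q = t * (q * Q) by rewrite mulrCA mulrC mulKf.
have -> : t ^+ 2 * (q * (q * Q)) / q = t ^+ 2 * (q * Q) by rewrite mulrCA mulrC mulKf.
by field; nz.
Qed.

Lemma mac_shift1 j x1 x2 :
  (x2 - t * x1) * mac j (q * x1) x2 =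
  (x2 - t * q ^+ j * x1) * mac j x1 x2
  - (1 - t * q ^+ j) * pieri j * (x1 * x2) * mac j.-1 x1 x2.
Proof.
by rewrite mac_sym mac_shift2 mac_sym [mac j.-1 _ _]mac_sym [x2 * x1]mulrC.
Qed.

Lemma mac_eigen j x1 x2 :
  (t * x1 - x2) * mac j (q * x1) x2 + (x1 - t * x2) * mac j x1 (q * x2)
  = (1 + t * q ^+ j) * (x1 - x2) * mac j x1 x2.
Proof.
by rewrite mac_shift2 -[t * x1 - x2]opprB mulNr mac_shift1; ring.
Qed.

(** In [mac_eigen] the M_(j-1) terms of the two shift relations cancel. With the extra weights x_1
    and x_2 the terms in [t * q ^ j] multiplying M_j cancel instead, which leaves (x_1 + x_2) M_j,
    and the Pieri rule brings in M_(j+1). *)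
Lemma mac_raise j x1 x2 :
  x2 * (t * x1 - x2) * mac j (q * x1) x2 + x1 * (x1 - t * x2) * mac j x1 (q * x2)
  = (x1 - x2) * (mac j.+1 x1 x2 + t * q ^+ j * pieri j * (x1 * x2) * mac j.-1 x1 x2).
Proof.
rewrite [LHS](_ : _ = x1 * ((x1 - t * x2) * mac j x1 (q * x2))
  - x2 * ((x2 - t * x1) * mac j (q * x1) x2)); last by ring.
by rewrite mac_shift1 mac_shift2 macS; ring.
Qed.

Lemma laurent_sum j (c : int -> K) (k N : nat) x1 x2 :
  (forall d : int, c d != 0 -> exists2 n : nat, (n < N)%N & d = n%:Z - k%:Z) ->
  laurent j c x1 x2 = x1 ^+ j * \sum_(n < N) c (n%:Z - k%:Z) * (x2 / x1) ^ (n%:Z - k%:Z).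
Proof.
move=> cN; rewrite /laurent; congr (_ * _).
pose s := [seq n%:Z - k%:Z | n <- iota 0 N].
rewrite -(fsbig_widen [set` s]) //; last first.
  move=> d /= [_ ds]; apply/eqP/negPn/negP => cd; apply: ds.
  have /cN[n nN ->] : c d != 0 by apply: contraNneq cd => ->; rewrite mul0r.
  by apply/mapP; exists n; rewrite ?mem_iota.
rewrite -fsbig_seq; last by rewrite map_inj_uniq ?iota_uniq // => m n; lia.
rewrite big_map -(big_mkord xpredT (fun n => c (n%:Z - k%:Z) * (x2 / x1) ^ (n%:Z - k%:Z))).
by rewrite /index_iota subn0.
Qed.

Lemma laurent_rogers j x1 x2 : x1 != 0 -> laurent j (rogers j) x1 x2 = mac j x1 x2.
Proof.
move=> x10; rewrite (@laurent_sum j _ 0 j.+1) => [|d].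
  rewrite -(rgen_mac q0 t0 qn tqn) //; congr (_ * _); apply: eq_bigr => n _.
  by rewrite subr0.
case: d => n; last by rewrite rogers_neg ?eqxx.
move=> r0; exists n; rewrite ?subr0 // ltnS leqNgt; apply: contraNN r0 => jn.
by rewrite rogers_big.
Qed.

Definition level1_poly (s : K) (j : nat) (x1 x2 : K) : K :=
  weightA q t *
  (weightP q t s j * mac j.+2 x1 x2
   + weight0 q t s * (pieri j.+1 + pieri j) * (x1 * x2) * mac j x1 x2
   + weightM q t s j * (pieri j * pieri j.-1) * (x1 * x2) ^+ 2 * mac j.-2 x1 x2)
  / (x1 * x2).

Lemma laurent_level1 s j x1 x2 : x1 != 0 -> x2 != 0 ->
  laurent j (fun d => level1_coef q t s j (d + 1)) x1 x2 = level1_poly s j x1 x2.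
Proof.
move=> x10 x20; rewrite (@laurent_sum j _ 1 j.+3) => [|d]; last first.
  move=> c0; have d0 : 0 <= d + 1.
    rewrite leNgt; apply: contraNN c0 => d0.
    by rewrite /level1_coef !rogers_neg ?mulr0 ?addr0 ?mulr0 //; lia.
  exists (absz (d + 1)); last by rewrite gez0_abs //; lia.
  rewrite ltnNge; apply: contraNN c0 => jd.
  by rewrite /level1_coef !rogers_big ?mulr0 ?addr0 ?mulr0 //; lia.
have r0 : x2 / x1 != 0 by rewrite mulf_neq0 ?invr_neq0.
rewrite (eq_bigr (fun n : 'I_j.+3 => (x2 / x1)^-1 * (weightA q t *
   (weightP q t s j * (rogers j.+2 (n%:Z - 0%N%:Z) * (x2 / x1) ^+ n)
    + weight0 q t s * (pieri j.+1 + pieri j) * (rogers j (n%:Z - 1%N%:Z) * (x2 / x1) ^+ n)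
    + weightM q t s j * (pieri j * pieri j.-1) * (rogers j.-2 (n%:Z - 2%N%:Z) * (x2 / x1) ^+ n)))));
    last first.
  move=> n _; rewrite expfzDr // exprN1 -exprnP (_ : n%:Z - 1%N%:Z + 1 = n%:Z); last by lia.
  rewrite /level1_coef subr0; ring.
rewrite -mulr_sumr -mulr_sumr !big_split /= -!mulr_sumr !rgen_shift; try lia.
rewrite expr0 expr1 mul1r /level1_poly.
rewrite -!(rgen_mac q0 t0 qn tqn) //.
(* For [j < 2] the truncated [j.-2] gives the last term the wrong degree, which is harmless because
   its coefficient is 0. *)
have [j2|] := ltnP j 2.
  have -> : pieri j * pieri j.-1 = 0.
    by case: j j2 => [|[|]] //= _; rewrite pieri0 ?mul0r ?mulr0.
  move: (rgen _ _) (rgen _ _) (rgen _ _) => a b c; rewrite !exprS; field; nz.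
case: j => [|[|j]] //= _.
move: (rgen _ _) (rgen _ _) (rgen _ _) => a b c; rewrite !exprS; field; nz.
Qed.

End MacdonaldShift.

(** * Laurent polynomials and the abstract Gaussian functional *)

Section LaurentClass.
Variable K : fieldType.
Implicit Types F G : K -> K -> K.

Definition mono_eval (m : K * int * int) (x1 x2 : K) : K :=
  m.1.1 * x1 ^ m.1.2 * x2 ^ m.2.

Definition laurent_rep F (l : seq (K * int * int)) : Prop :=
  forall x1 x2, x1 != 0 -> x2 != 0 -> F x1 x2 = \sum_(m <- l) mono_eval m x1 x2.

Definition is_laurent F : Prop := exists l, laurent_rep F l.

Lemma is_laurent_ext F G :
  (forall x1 x2, x1 != 0 -> x2 != 0 -> F x1 x2 = G x1 x2) -> is_laurent F -> is_laurent G.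
Proof. by move=> FG [l Fl]; exists l => x1 x2 x10 x20; rewrite -FG // Fl. Qed.

Lemma is_laurentC c : is_laurent (fun _ _ => c).
Proof. by exists [:: (c, 0, 0)] => x1 x2 _ _; rewrite big_seq1 /mono_eval !expr0z !mulr1. Qed.

Lemma is_laurent1 : is_laurent (fun x1 _ => x1).
Proof.
by exists [:: (1, 1, 0)] => x1 x2 _ _; rewrite big_seq1 /mono_eval expr1z expr0z mul1r mulr1.
Qed.

Lemma is_laurent2 : is_laurent (fun _ x2 => x2).
Proof.
by exists [:: (1, 0, 1)] => x1 x2 _ _; rewrite big_seq1 /mono_eval expr1z expr0z !mul1r.
Qed.

Lemma is_laurentV1 : is_laurent (fun x1 _ => x1^-1).
Proof.
by exists [:: (1, -1, 0)] => x1 x2 _ _; rewrite big_seq1 /mono_eval exprN1 expr0z mul1r mulr1.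
Qed.

Lemma is_laurentV2 : is_laurent (fun _ x2 => x2^-1).
Proof.
by exists [:: (1, 0, -1)] => x1 x2 _ _; rewrite big_seq1 /mono_eval exprN1 expr0z !mul1r.
Qed.

Lemma is_laurentD F G : is_laurent F -> is_laurent G -> is_laurent (fun x1 x2 => F x1 x2 + G x1 x2).
Proof. by move=> [l Fl] [k Gk]; exists (l ++ k) => x1 x2 *; rewrite big_cat Fl // Gk. Qed.

Lemma is_laurentM F G : is_laurent F -> is_laurent G -> is_laurent (fun x1 x2 => F x1 x2 * G x1 x2).
Proof.
move=> [l Fl] [k Gk].
exists [seq (m.1.1 * n.1.1, m.1.2 + n.1.2, m.2 + n.2) | m <- l, n <- k] => x1 x2 x10 x20.
rewrite big_allpairs_dep Fl // Gk // mulr_suml; apply: eq_bigr => m _.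
rewrite mulr_sumr; apply: eq_bigr => n _; rewrite /mono_eval /= !expfzDr //.
by move: (x1 ^ _) (x1 ^ _) (x2 ^ _) (x2 ^ _) => *; ring.
Qed.

Lemma is_laurentV12 : is_laurent (fun x1 x2 => (x1 * x2)^-1).
Proof.
apply: (is_laurent_ext (F := fun x1 x2 => x1^-1 * x2^-1)) => [x1 x2 _ _|].
  by rewrite invfM.
by apply: is_laurentM; [exact: is_laurentV1 | exact: is_laurentV2].
Qed.

Lemma is_laurentN F : is_laurent F -> is_laurent (fun x1 x2 => - F x1 x2).
Proof.
move=> FL; apply: is_laurent_ext (is_laurentM (is_laurentC (-1)) FL) => x1 x2 _ _.
by rewrite mulN1r.
Qed.

Lemma is_laurentB F G : is_laurent F -> is_laurent G -> is_laurent (fun x1 x2 => F x1 x2 - G x1 x2).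
Proof. by move=> FL GL; apply: is_laurentD => //; apply: is_laurentN. Qed.

Lemma is_laurent_prod (I : Type) (r : seq I) (F : I -> K -> K -> K) :
  (forall i, is_laurent (F i)) -> is_laurent (fun x1 x2 => \prod_(i <- r) F i x1 x2).
Proof.
move=> FL; elim: r => [|i r IH].
  by apply: is_laurent_ext (is_laurentC 1) => x1 x2 _ _; rewrite big_nil.
by apply: is_laurent_ext (is_laurentM (FL i) IH) => x1 x2 _ _; rewrite big_cons.
Qed.

Lemma is_laurent_scale F c d : c != 0 -> d != 0 ->
  is_laurent F -> is_laurent (fun x1 x2 => F (c * x1) (d * x2)).
Proof.
move=> c0 d0 [l Fl].
exists [seq (m.1.1 * c ^ m.1.2 * d ^ m.2, m.1.2, m.2) | m <- l] => x1 x2 x10 x20.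
rewrite big_map Fl ?mulf_neq0 //; apply: eq_bigr => m _.
by rewrite /mono_eval /= !exprzMl ?unitfE //; ring.
Qed.

Lemma is_laurent_mac (q t : K) j : is_laurent (mac q t j).
Proof.
elim/ltn_ind: j => -[|j] IH; first exact: is_laurentC.
apply: (is_laurent_ext (F := fun x1 x2 => (x1 + x2) * mac q t j x1 x2
  - pieri q t j * (x1 * x2) * mac q t j.-1 x1 x2)) => [x1 x2 _ _|]; first by rewrite macS.
apply: is_laurentB; apply: is_laurentM; try (by apply: IH; case: (j)).
  by apply: is_laurentD; [exact: is_laurent1|exact: is_laurent2].
apply: is_laurentM; first exact: is_laurentC.
by apply: is_laurentM; [exact: is_laurent1|exact: is_laurent2].
Qed.

Variables (qh : K) (L : (K -> K -> K) -> K).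
Hypothesis qh0 : qh != 0.
(** With [qh = e^(g/2)] these are the Gaussian moments of the monomials. Since the formula holds for
    every representation of [F], well-definedness is built in and linear independence of monomials
    never has to be proved. *)
Hypothesis L_rep : forall F l, laurent_rep F l ->
  L F = \sum_(m <- l) m.1.1 * qh ^ (m.1.2 * m.1.2) * qh ^ (m.2 * m.2).

Local Notation q := (qh ^+ 2).

Lemma L_ext F G : is_laurent F ->
  (forall x1 x2, x1 != 0 -> x2 != 0 -> F x1 x2 = G x1 x2) -> L F = L G.
Proof.
move=> [l Fl] FG; rewrite (L_rep Fl); symmetry; apply: L_rep => x1 x2 x10 x20.
by rewrite -FG // Fl.
Qed.

Lemma L_D F G : is_laurent F -> is_laurent G -> L (fun x1 x2 => F x1 x2 + G x1 x2) = L F + L G.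
Proof.
move=> [l Fl] [k Gk]; rewrite (L_rep Fl) (L_rep Gk) -big_cat; apply: L_rep => x1 x2 x10 x20.
by rewrite big_cat Fl // Gk.
Qed.

Lemma L_Z c F : is_laurent F -> L (fun x1 x2 => c * F x1 x2) = c * L F.
Proof.
move=> [l Fl]; rewrite (L_rep Fl) (L_rep (l := [seq (c * m.1.1, m.1.2, m.2) | m <- l])).
  by rewrite big_map mulr_sumr; apply: eq_bigr => m _; rewrite /= !mulrA.
move=> x1 x2 x10 x20; rewrite big_map Fl // mulr_sumr.
by apply: eq_bigr => m _; rewrite /mono_eval /= !mulrA.
Qed.

Lemma L_swap F : is_laurent F -> L (fun x1 x2 => F x2 x1) = L F.
Proof.
move=> [l Fl]; rewrite (L_rep Fl) (L_rep (l := [seq (m.1.1, m.2, m.1.2) | m <- l])).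
  by rewrite big_map; apply: eq_bigr => m _; rewrite /= mulrAC.
by move=> x1 x2 x10 x20; rewrite big_map Fl //; apply: eq_bigr => m _; rewrite /mono_eval /= mulrAC.
Qed.

(** On monomials this is (a + 1)^2 = a^2 + 2a + 1: the term 2a becomes the shift by [q], the 1 the
    factor [qh]. *)
Lemma L_mul1 F : is_laurent F ->
  L (fun x1 x2 => x1 * F x1 x2) = qh * L (fun x1 x2 => F (q * x1) x2).
Proof.
move=> [l Fl].
rewrite (L_rep (l := [seq (m.1.1, m.1.2 + 1, m.2) | m <- l])); last first.
  move=> x1 x2 x10 x20; rewrite big_map Fl // mulr_sumr.
  by apply: eq_bigr => m _; rewrite /mono_eval /= expfzDr // expr1z; ring.
rewrite (L_rep (l := [seq (m.1.1 * q ^ m.1.2, m.1.2, m.2) | m <- l])); last first.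
  move=> x1 x2 x10 x20; rewrite big_map Fl ?mulf_neq0 ?expf_neq0 //.
  by apply: eq_bigr => m _; rewrite /mono_eval /= exprzMl ?unitfE ?expf_neq0 //; ring.
rewrite !big_map mulr_sumr; apply: eq_bigr => m _ /=.
have -> : qh ^ ((m.1.2 + 1) * (m.1.2 + 1)) = qh * (q ^ m.1.2 * qh ^ (m.1.2 * m.1.2)).
  rewrite (exprnP qh 2) exprz_exp -{2}[qh]expr1z -!expfzDr //; congr (_ ^ _); ring.
ring.
Qed.

Lemma L_mul2 F : is_laurent F ->
  L (fun x1 x2 => x2 * F x1 x2) = qh * L (fun x1 x2 => F x1 (q * x2)).
Proof.
move=> FL; have [l Fl] := FL.
have F'L : is_laurent (fun x1 x2 => F x2 x1).
  exists [seq (m.1.1, m.2, m.1.2) | m <- l] => x1 x2 x10 x20; rewrite big_map Fl //.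
  by apply: eq_bigr => m _; rewrite /mono_eval /= mulrAC.
rewrite -(L_swap (is_laurentM is_laurent2 FL)) (L_mul1 F'L); congr (_ * _).
have q0 : q != 0 by rewrite expf_neq0.
apply: (L_swap (F := fun x1 x2 => F x1 (q * x2))).
apply: is_laurent_ext (is_laurent_scale (oner_neq0 _) q0 FL) => x1 x2 _ _.
by rewrite mul1r.
Qed.

Lemma L_mul12 F : is_laurent F ->
  L (fun x1 x2 => x1 * x2 * F x1 x2) = q * L (fun x1 x2 => F (q * x1) (q * x2)).
Proof.
move=> FL; have q0 : q != 0 by rewrite expf_neq0.
rewrite (L_ext (G := fun x1 x2 => x1 * (x2 * F x1 x2))) => [|| x1 x2 _ _]; last first.
- by rewrite mulrA.
- by apply: is_laurentM FL; apply: is_laurentM; [exact: is_laurent1|exact: is_laurent2].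
rewrite (L_mul1 (is_laurentM is_laurent2 FL)) L_mul2 ?mulrA ?expr2 //.
apply: is_laurent_ext (is_laurent_scale q0 (oner_neq0 _) FL) => x1 x2 _ _.
by rewrite mul1r.
Qed.

End LaurentClass.

(** * The kernel of order 0 and its behaviour under shifts *)

Section Kernel.
Variables (K : fieldType) (q : K).
Hypothesis q0 : q != 0.

Definition kernel_factor (m : nat) (x1 x2 : K) : K :=
  (1 - q ^+ m * (x1 / x2)) * (1 - q ^+ m * (x2 / x1)).

Definition delta (b : nat) (x1 x2 : K) : K := \prod_(m < b) kernel_factor m x1 x2.

(* [delta b.+1] divided by [x1 - x2] *)
Definition half_delta (b : nat) (x1 x2 : K) : K :=
  - ((x1 - x2) / (x1 * x2)) * \prod_(m < b) kernel_factor m.+1 x1 x2.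

(** The factor [m = 0] of the kernel is - (x_1 - x_2)^2 / (x_1 x_2), so one factor x_1 - x_2 can be
    given to the shift relations while the rest stays an antisymmetric Laurent polynomial. *)
Lemma delta_half b x1 x2 : x1 != 0 -> x2 != 0 ->
  delta b.+1 x1 x2 = (x1 - x2) * half_delta b x1 x2.
Proof.
move=> x10 x20; rewrite /delta /half_delta big_ord_recl mulrA; congr (_ * _).
by rewrite /kernel_factor expr0; field; nz.
Qed.

(** Shifting x_1 raises the index of each factor in x_1 / x_2 and lowers that of each factor in x_2
    / x_1, so the product changes only at its two ends. The cross-multiplied form stays true where
    an end factor vanishes. *)
Lemma kernel_prod_shift b x1 x2 : x1 != 0 -> x2 != 0 ->
  (1 - q * (x1 / x2)) * (1 - q ^+ b * (x2 / x1))
    * \prod_(m < b) kernel_factor m.+1 (q * x1) x2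
  = (1 - q ^+ b.+1 * (x1 / x2)) * (1 - x2 / x1) * \prod_(m < b) kernel_factor m.+1 x1 x2.
Proof.
move=> x10 x20; elim: b => [|b IH]; first by rewrite !big_ord0 expr0 expr1 mul1r.
rewrite !big_ord_recr /= {2 4}/kernel_factor.
have -> : q ^+ b.+1 * (x2 / (q * x1)) = q ^+ b * (x2 / x1) by rewrite exprS; field; nz.
have -> : q ^+ b.+1 * (q * x1 / x2) = q ^+ b.+2 * (x1 / x2) by rewrite [q ^+ b.+2]exprS; ring.
transitivity ((1 - q * (x1 / x2)) * (1 - q ^+ b * (x2 / x1)) *
     \prod_(m < b) kernel_factor m.+1 (q * x1) x2
   * ((1 - q ^+ b.+1 * (x2 / x1)) * (1 - q ^+ b.+2 * (x1 / x2)))); first by ring.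
by rewrite IH; ring.
Qed.

Lemma half_delta_shift b x1 x2 : x1 != 0 -> x2 != 0 ->
  (q * x1 - q ^+ b.+1 * x2) * half_delta b (q * x1) x2
  = (q ^+ b.+1 * x1 - x2) * half_delta b x1 x2.
Proof.
move=> x10 x20; have H := kernel_prod_shift b x10 x20.
rewrite /half_delta !mulrA.
rewrite [X in X * _ = _](_ : _ = (1 - q * (x1 / x2)) * (1 - q ^+ b * (x2 / x1))).
  by rewrite H; congr (_ * _); field; nz.
by rewrite exprS; field; nz.
Qed.

Lemma half_delta_anti b x1 x2 : half_delta b x2 x1 = - half_delta b x1 x2.
Proof.
rewrite /half_delta [x2 * x1]mulrC (eq_bigr (fun m : 'I_b => kernel_factor m.+1 x1 x2)).
  ring.
by move=> m _; rewrite /kernel_factor mulrC.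
Qed.

Lemma delta_scale b c x1 x2 : c != 0 -> delta b (c * x1) (c * x2) = delta b x1 x2.
Proof.
move=> c0; apply: eq_bigr => m _; rewrite /kernel_factor -!mulf_div divff // !mul1r //.
Qed.

Lemma is_laurent_kernel m : is_laurent (kernel_factor m).
Proof.
apply: is_laurentM; apply: is_laurentB; try exact: is_laurentC.
  apply: is_laurentM; first exact: is_laurentC.
  by apply: is_laurentM; [exact: is_laurent1|exact: is_laurentV2].
apply: is_laurentM; first exact: is_laurentC.
by apply: is_laurentM; [exact: is_laurent2|exact: is_laurentV1].
Qed.

Lemma is_laurent_delta b : is_laurent (delta b).
Proof. by apply: is_laurent_prod => i; exact: is_laurent_kernel. Qed.

Lemma is_laurent_half_delta b : is_laurent (half_delta b).
Proof.
apply: is_laurentM; last by apply: is_laurent_prod => i; exact: is_laurent_kernel.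
apply: is_laurentN.
apply: is_laurentM; last exact: is_laurentV12.
by apply: is_laurentB; [exact: is_laurent1|exact: is_laurent2].
Qed.

Lemma is_laurent_shift1 (t : K) j : is_laurent (fun x1 x2 => mac q t j (q * x1) x2).
Proof.
apply: is_laurent_ext (is_laurent_scale q0 (oner_neq0 _) (is_laurent_mac q t j)) => x1 x2 _ _.
by rewrite mul1r.
Qed.

Lemma is_laurent_shift2 (t : K) j : is_laurent (fun x1 x2 => mac q t j x1 (q * x2)).
Proof.
apply: is_laurent_ext (is_laurent_scale (oner_neq0 _) q0 (is_laurent_mac q t j)) => x1 x2 _ _.
by rewrite mul1r.
Qed.

End Kernel.

Ltac laurent := repeat first
  [ assumption | exact: is_laurent_mac | exact: is_laurent_delta
  | exact: is_laurent_half_delta | exact: is_laurentC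
  | exact: is_laurent1 | exact: is_laurent2 | exact: is_laurentV1 | exact: is_laurentV2
  | exact: is_laurentV12
  | apply: is_laurentB | apply: is_laurentD | apply: is_laurentM | apply: is_laurentN ].

(** * The pairing of two Macdonald polynomials: order p ^ 0 *)

Section Pairing.
Variables (K : fieldType) (qh : K) (b : nat) (L : (K -> K -> K) -> K).
Local Notation q := (qh ^+ 2).
Local Notation beta := b.+1.
Local Notation t := (q ^+ beta).
Local Notation th := (qh ^+ beta).
Hypotheses (qh0 : qh != 0).
Hypotheses (qn : forall n : nat, 1 - q ^+ n.+1 != 0).
Hypotheses (tqn : forall n : nat, 1 - t * q ^+ n != 0).
Hypothesis L_rep : forall F l, laurent_rep F l ->
  L F = \sum_(m <- l) m.1.1 * qh ^ (m.1.2 * m.1.2) * qh ^ (m.2 * m.2).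

Local Notation mac := (mac q t).
Local Notation pieri := (pieri q t).

Let q0 : q != 0. Proof. by rewrite expf_neq0. Qed.
Let t0 : t != 0. Proof. by rewrite expf_neq0. Qed.

Definition pairing (i j : nat) : K :=
  L (fun x1 x2 => mac i x1 x2 * mac j x1 x2 * delta q beta x1 x2).

Lemma pairing_sym i j : pairing i j = pairing j i.
Proof.
rewrite /pairing; apply: (L_ext L_rep) => [|x1 x2 _ _]; first by laurent.
by rewrite [X in X * _]mulrC.
Qed.

(** Multiplication by x_1 x_2 scales both variables by [q], and the integrand is homogeneous of
    degree [i + j], the kernel having degree 0. *)
Lemma L_mul12_pairing i j :
  L (fun x1 x2 => x1 * x2 * (mac i x1 x2 * mac j x1 x2 * delta q beta x1 x2))
  = q ^+ (i + j).+1 * pairing i j.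
Proof.
rewrite (L_mul12 qh0 L_rep); last by laurent.
rewrite [q ^+ (i + j).+1]exprS -mulrA; congr (_ * _).
rewrite /pairing -(L_Z L_rep); last by laurent.
apply: (L_ext L_rep) => [|x1 x2 _ _].
  apply: (is_laurent_scale
    (F := fun x1 x2 => mac i x1 x2 * mac j x1 x2 * delta q beta x1 x2)) => //.
  by laurent.
by rewrite !mac_scale delta_scale // exprD; ring.
Qed.

(** Read from right to left: the factor x_1 shifts x_1 by [q]. This turns [mac i x1 (q * x2)] into
    [q ^+ i * mac i x1 x2] by homogeneity, shifts M_j, and [half_delta_shift] trades
    [q * x1 - t * x2] for [t * x1 - x2]. The shift has passed from M_j to the other variable of
    M_i. *)
Lemma L_mul1_pairing i j :
  L (fun x1 x2 => mac i x1 x2 * ((t * x1 - x2) * mac j (q * x1) x2) * half_delta q b x1 x2)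
  = (qh * q ^+ i)^-1 *
    L (fun x1 x2 => x1 * ((x1 - t * x2) * mac i x1 (q * x2)) * mac j x1 x2 * half_delta q b x1 x2).
Proof.
pose G x1 x2 := (x1 - t * x2) * mac i x1 (q * x2) * mac j x1 x2 * half_delta q b x1 x2.
have qx1 := is_laurent_shift1 q0 t; have qx2 := is_laurent_shift2 q0 t.
have GL : is_laurent G by rewrite /G; laurent.
apply: (mulfI (mulf_neq0 qh0 (expf_neq0 i q0))); rewrite mulVKf ?mulf_neq0 ?expf_neq0 //.
rewrite -mulrA [RHS](L_ext L_rep (G := fun x1 x2 => x1 * G x1 x2)); last 2 first.
- by laurent.
- by move=> x1 x2 _ _; rewrite /G !mulrA.
rewrite (L_mul1 qh0 L_rep GL); congr (_ * _).
rewrite -(L_Z L_rep); last by laurent.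
apply: (L_ext L_rep) => [|x1 x2 x10 x20]; first by laurent.
rewrite /G mac_scale; have := half_delta_shift q0 b x10 x20 => H.
transitivity (q ^+ i * mac i x1 x2 * mac j (q * x1) x2 * ((t * x1 - x2) * half_delta q b x1 x2)).
  by ring.
by rewrite -H; ring.
Qed.

Lemma L_mul2_pairing i j :
  L (fun x1 x2 => mac i x1 x2 * ((x1 - t * x2) * mac j x1 (q * x2)) * half_delta q b x1 x2)
  = (qh * q ^+ i)^-1 *
    L (fun x1 x2 => x2 * ((t * x1 - x2) * mac i (q * x1) x2) * mac j x1 x2 * half_delta q b x1 x2).
Proof.
have qx1 := is_laurent_shift1 q0 t; have qx2 := is_laurent_shift2 q0 t.
rewrite -(L_swap L_rep); last by laurent.
rewrite -[in RHS](L_swap L_rep); last by laurent.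
rewrite (L_ext L_rep (G := fun x1 x2 =>
  mac i x1 x2 * ((t * x1 - x2) * mac j (q * x1) x2) * half_delta q b x1 x2)).
- rewrite L_mul1_pairing; congr (_ * _); apply: (L_ext L_rep) => [|x1 x2 _ _]; first by laurent.
  rewrite half_delta_anti [mac i (q * x2) x1]mac_sym [mac j x2 x1]mac_sym; ring.
- apply: is_laurentM; last first.
    apply: is_laurent_ext (is_laurentN (is_laurent_half_delta q b)) => x1 x2 _ _.
    by rewrite [RHS]half_delta_anti.
  apply: is_laurentM.
    by apply: is_laurent_ext (is_laurent_mac q t i) => x1 x2 _ _; rewrite mac_sym.
  apply: is_laurentM; first by laurent.
  by apply: is_laurent_ext (qx1 j) => x1 x2 _ _; rewrite mac_sym.
- move=> x1 x2 _ _.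
  rewrite half_delta_anti [mac j x2 _]mac_sym [mac i x2 x1]mac_sym; ring.
Qed.

Lemma pairing_rec i j :
  (1 + t * q ^+ j) * pairing i j =
  (qh * q ^+ i)^-1 *
    (pairing i.+1 j + t * q ^+ i * pieri i * (q ^+ (i + j) * pairing i.-1 j)).
Proof.
have qx1 := is_laurent_shift1 q0 t; have qx2 := is_laurent_shift2 q0 t.
have -> : t * q ^+ i * pieri i * (q ^+ (i + j) * pairing i.-1 j) = t * q ^+ i * pieri i *
    L (fun x1 x2 => x1 * x2 * (mac i.-1 x1 x2 * mac j x1 x2 * delta q beta x1 x2)).
  case: i => [|i]; first by rewrite pieri0 !(mulr0, mul0r).
  by rewrite L_mul12_pairing addSn.
rewrite /pairing -(L_Z L_rep); last by laurent.
rewrite -(L_Z L_rep); last by laurent.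
rewrite -(L_D L_rep); [|by laurent|by laurent].
transitivity (L (fun x1 x2 =>
  mac i x1 x2 * ((t * x1 - x2) * mac j (q * x1) x2) * half_delta q b x1 x2 +
  mac i x1 x2 * ((x1 - t * x2) * mac j x1 (q * x2)) * half_delta q b x1 x2)).
  apply: (L_ext L_rep) => [|x1 x2 x10 x20]; first by laurent.
  rewrite delta_half // -mulrDl -mulrDr (mac_eigen q0 tqn); ring.
rewrite [LHS](L_D L_rep); [|by laurent|by laurent].
rewrite L_mul1_pairing L_mul2_pairing -mulrDr; congr (_ * _).
rewrite -(L_D L_rep); [|by laurent|by laurent].
apply: (L_ext L_rep) => [|x1 x2 x10 x20]; first by laurent.
have H := mac_raise q0 tqn i x1 x2.
transitivity ((x2 * (t * x1 - x2) * mac i (q * x1) x2 + x1 * (x1 - t * x2) * mac i x1 (q * x2))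
  * (mac j x1 x2 * half_delta q b x1 x2)); first by ring.
by rewrite H !delta_half //; ring.
Qed.

Local Notation u1 j := (th * qh ^+ j).
Local Notation u2 j := (th^-1 * qh ^- j).

(** At the spectral point [u1 * u2 = 1] and [u1 + u2 = (1 + t * q ^ j) / (th * qh ^ j)]. Once the
    Gaussian power is split off, [pairing_rec] is therefore the recursion [macS] at that point. *)
Lemma pairing_from_base j :
  pairing 0 j = pairing 0 0 * qh ^+ (j * (j + beta)) * mac j th th^-1 ->
  forall i, pairing i j = pairing 0 0 * qh ^+ (i * (i + beta) + i * j + j * (j + beta))
    * mac j th th^-1 * mac i (u1 j) (u2 j).
Proof.
move=> base; elim/ltn_ind => -[|i] IH.
  by rewrite base mul0n add0n mul0n add0n mulr1.
have qE n : q ^+ n = qh ^+ n * qh ^+ n by rewrite -exprM mul2n -addnn exprD.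
have E : pairing i.+1 j = qh * q ^+ i * (1 + t * q ^+ j) * pairing i j
    - t * q ^+ i * q ^+ (i + j) * (pieri i * pairing i.-1 j).
  rewrite -[qh * q ^+ i * _ * _]mulrA pairing_rec mulVKf ?mulf_neq0 ?expf_neq0 //; ring.
rewrite {}E (IH i) // macS.
pose X k := (k * (k + beta) + k * j + j * (j + beta))%N.
have XS k : qh ^+ X k.+1 = qh ^+ X k * (qh ^+ k * qh ^+ k * qh * th * qh ^+ j).
  by rewrite -!exprD -exprSr -!exprD; congr (_ ^+ _); rewrite /X; ring.
rewrite -/(X i) -/(X i.+1) XS exprD.
have n1 k : qh ^+ k != 0 by rewrite expf_neq0.
have := n1 beta; have := n1 j; have := n1 i.
case: i IH => [|i] IH.
  rewrite pieri0 /mac !qE expr0.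
  by move: th (qh ^+ j) (qh ^+ X 0) => T c E *; field; nz.
rewrite /= (IH i) // -/(X i) XS.
move: (pairing 0 0) (mac j _ _) (mac i _ _) (mac i.+1 _ _) (pieri _) => p m1 m2 m3 f.
rewrite !qE [qh ^+ i.+1]exprS.
by move: th (qh ^+ j) (qh ^+ X i) (qh ^+ i) => T c E a *; field; nz.
Qed.

(** For [j = 0] the base of the recursion is trivial; this gives all [pairing i 0], hence by
    symmetry the base for every [j]. A second use of symmetry interchanges the roles of [i] and
    [j]. *)
Lemma pairing_eval i j :
  pairing i j = pairing 0 0 * qh ^+ (i * (i + beta) + i * j + j * (j + beta))
    * mac i th th^-1 * mac j (u1 i) (u2 i).
Proof.
have base k : pairing 0 k = pairing 0 0 * qh ^+ (k * (k + beta)) * mac k th th^-1.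
  rewrite pairing_sym pairing_from_base; last by rewrite expr0 !mulr1.
  by rewrite muln0 mul0n !addn0 expr0 !mulr1 invr1 mulr1.
rewrite pairing_sym (pairing_from_base (base i)).
by congr (_ * _ ^+ _ * _ * _); ring.
Qed.

End Pairing.

(** * The coefficient of p of the integral *)

Section FirstOrder.
Variables (K : fieldType) (qh : K) (b : nat) (L : (K -> K -> K) -> K).
Local Notation q := (qh ^+ 2).
Local Notation beta := b.+1.
Local Notation t := (q ^+ beta).
Local Notation th := (qh ^+ beta).
Hypotheses (qh0 : qh != 0).
Hypotheses (qn : forall n : nat, 1 - q ^+ n.+1 != 0).
Hypotheses (tqn : forall n : nat, 1 - t * q ^+ n != 0).
Hypothesis L_rep : forall F l, laurent_rep F l ->
  L F = \sum_(m <- l) m.1.1 * qh ^ (m.1.2 * m.1.2) * qh ^ (m.2 * m.2).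

Local Notation mac := (mac q t).
Local Notation pieri := (pieri q t).
Local Notation A := (weightA q t).
Local Notation pairing := (pairing qh b L).
Local Notation u1 j := (th * qh ^+ j).
Local Notation u2 j := (th^-1 * qh ^- j).

Let q0 : q != 0. Proof. by rewrite expf_neq0. Qed.
Let t0 : t != 0. Proof. by rewrite expf_neq0. Qed.

Definition kappa : K := \sum_(m < beta) (q ^+ m + q ^- m).

(** For [t = q ^ beta], [A] is the sum of [q ^- m] and [t / q * A] the sum of [q ^+ m] over
    [m < beta]. *)
Lemma kappaE : kappa = A + t / q * A.
Proof.
have q1 : 1 - q != 0 := qn 0.
rewrite /kappa /weightA; move: q q0 q1 => x x0 x1.
elim: beta => [|n IH]; first by rewrite big_ord0 expr0 subrr !(mul0r, mulr0) addr0.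
rewrite big_ord_recr /= IH exprS; have := expf_neq0 n x0.
by move: (x ^+ n) => y y0; field; nz.
Qed.

Lemma mac_square j x1 x2 :
  mac j.+2 x1 x2 + (pieri j.+1 + pieri j) * (x1 * x2) * mac j x1 x2
  + pieri j * pieri j.-1 * (x1 * x2) ^+ 2 * mac j.-2 x1 x2 = (x1 + x2) ^+ 2 * mac j x1 x2.
Proof.
rewrite (macS _ _ j.+1) (macS _ _ j) /=.
case: j => [|j]; first by rewrite pieri0; ring.
by rewrite /= (macS _ _ j); ring.
Qed.

Lemma level1_poly0 j x1 x2 : x1 != 0 -> x2 != 0 ->
  level1_poly q t 0 j x1 x2 = A * ((x1 + x2) ^+ 2 / (x1 * x2)) * mac j x1 x2.
Proof.
move=> x10 x20; rewrite /level1_poly /weightP /weight0 /weightM !(mulr0, mul0r) !subr0 divr1 !mul1r.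
by rewrite mac_square; ring.
Qed.

(** The coefficient of p of the integrand by the product rule: first the theta functions, then P_j
    at [s], then P_i, which enters at [s = 0] because its parameter is [p / s]. *)
Definition first_order (s : K) (i j : nat) (x1 x2 : K) : K :=
  mac i x1 x2 * mac j x1 x2 * (- kappa * (x1 / x2 + x2 / x1) * delta q beta x1 x2)
  + (mac i x1 x2 * level1_poly q t s j x1 x2 + level1_poly q t 0 i x1 x2 * mac j x1 x2)
    * delta q beta x1 x2.

Lemma first_orderE s i j x1 x2 : x1 != 0 -> x2 != 0 ->
  first_order s i j x1 x2 =
  (2 * kappa + A * (weight0 q t s - t / q) * (pieri j.+1 + pieri j))
     * (mac i x1 x2 * mac j x1 x2 * delta q beta x1 x2)
  + A * (weightP q t s j - t / q)
     * ((x1 * x2)^-1 * (mac i x1 x2 * mac j.+2 x1 x2 * delta q beta x1 x2))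
  + A * (weightM q t s j - t / q) * (pieri j * pieri j.-1)
     * (x1 * x2 * (mac i x1 x2 * mac j.-2 x1 x2 * delta q beta x1 x2)).
Proof.
move=> x10 x20; rewrite /first_order level1_poly0 // kappaE /level1_poly.
have H := mac_square j x1 x2.
have -> : mac j.+2 x1 x2 = (x1 + x2) ^+ 2 * mac j x1 x2 -
   ((pieri j.+1 + pieri j) * (x1 * x2) * mac j x1 x2
    + pieri j * pieri j.-1 * (x1 * x2) ^+ 2 * mac j.-2 x1 x2) by rewrite -H; ring.
move: (pieri _) (pieri _) (pieri _) (weightP _ _ _ _) (weight0 _ _ _) (weightM _ _ _ _).
move: (mac _ _ _) (mac _ _ _) (mac _ _ _) (delta _ _ _ _) A (t / q) => *.
by field; nz.
Qed.

Lemma L_div12_pairing i j :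
  L (fun x1 x2 => (x1 * x2)^-1 * (mac i x1 x2 * mac j.+2 x1 x2 * delta q beta x1 x2))
  = (q ^+ (i + j).+1)^-1 * pairing i j.+2.
Proof.
pose F x1 x2 := (x1 * x2)^-1 * (mac i x1 x2 * mac j.+2 x1 x2 * delta q beta x1 x2).
have FL : is_laurent F by rewrite /F; laurent.
have -> : pairing i j.+2 = L (fun x1 x2 => x1 * x2 * F x1 x2).
  apply: (L_ext L_rep) => [|x1 x2 x10 x20]; first by laurent.
  by rewrite /F mulVKf // mulf_neq0.
rewrite (L_mul12 qh0 L_rep FL).
have -> : L (fun x1 x2 => F (q * x1) (q * x2)) = q ^+ (i + j) * L F.
  rewrite -(L_Z L_rep) //; apply: (L_ext L_rep).
    exact: (is_laurent_scale q0 q0 FL).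
  move=> x1 x2 x10 x20; rewrite /F !mac_scale delta_scale //.
  by rewrite exprD [q ^+ j.+2]exprSr [q ^+ j.+1]exprSr; field; nz.
by rewrite mulrA -exprS mulKf // expf_neq0.
Qed.

Lemma L_first_order s i j : s != 0 -> 1 - s != 0 ->
  1 - t * q * q ^+ j * s != 0 -> 1 - q * s / (t * q ^+ j) != 0 ->
  L (first_order s i j) =
  qh ^+ (i * (i + beta) + i * j + j * (j + beta)) * mac i th th^-1
  * ((level1_poly q t s j (u1 i) (u2 i) - level1_poly q t 0 j (u1 i) (u2 i)) / s * pairing 0 0
     + mac j (u1 i) (u2 i) * (2 * kappa * pairing 0 0)).
Proof.
move=> s0 s1 sP sM; rewrite (L_ext L_rep _ (first_orderE s i j)); last first.
  rewrite /first_order /level1_poly; laurent.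
do 2 (rewrite (L_D L_rep); [|by laurent|by laurent]).
do 3 (rewrite (L_Z L_rep); [|by laurent]).
rewrite -/(pairing i j) L_div12_pairing.
set E := qh ^+ (_ + _ + _); set mi := mac i th _; set p00 := pairing 0 0.
have qE n : q ^+ n = qh ^+ n * qh ^+ n by rewrite -exprM mul2n -addnn exprD.
have n1 k : qh ^+ k != 0 by rewrite expf_neq0.
(* The change of the Gaussian power between [k] and [k + 2]. Its factor [q ^+ (i + k).+1] cancels
   against the one produced by dividing or multiplying by x_1 x_2, so M_(j+2), M_j, M_(j-2) get the
   factors [t * q ^+ j.+1], 1 and [q / (t * q ^+ j)]. *)
have E2 k : qh ^+ (i * (i + beta) + i * k.+2 + k.+2 * (k.+2 + beta)) =
    qh ^+ (i * (i + beta) + i * k + k * (k + beta)) * (q ^+ (i + k).+1 * (t * q ^+ k.+1)).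
  by rewrite -!exprM -!exprD; congr (_ ^+ _); ring.
have -> : (q ^+ (i + j).+1)^-1 * pairing i j.+2
    = p00 * E * mi * (t * q ^+ j.+1) * mac j.+2 (u1 i) (u2 i).
  rewrite (pairing_eval qh0 tqn L_rep) E2 -/E -/mi -/p00.
  by have := expf_neq0 (i + j).+1 q0; move: (q ^+ (i + j).+1) => x x0; field; nz.
rewrite -[A * _ * (pieri j * _) * _]mulrA.
have -> : pieri j * pieri j.-1 *
    L (fun x1 x2 => x1 * x2 * (mac i x1 x2 * mac j.-2 x1 x2 * delta q beta x1 x2))
    = pieri j * pieri j.-1 * (p00 * E * mi * (q / (t * q ^+ j)) * mac j.-2 (u1 i) (u2 i)).
  case: (j) @E E2 => [|[|k]] E E2; rewrite /= ?pieri0 ?(mulr0, mul0r) //.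
  rewrite (L_mul12_pairing _ qh0 L_rep) (pairing_eval qh0 tqn L_rep).
  rewrite /E E2 -/mi -/p00 [q ^+ k.+2]exprSr; congr (_ * _).
  have := expf_neq0 (i + k).+1 q0; have := expf_neq0 k.+1 q0.
  by move: (q ^+ (i + k).+1) (q ^+ k.+1) => x y *; field; nz.
rewrite (pairing_eval qh0 tqn L_rep) -/E -/mi -/p00.
(* Term by term, the integral now matches the quotient on the right of the theorem, whose
   coefficient of p is the difference of the level 1 polynomials at [s] and at 0, divided by [s] and
   by M_j. *)
have cP : (weightP q t s j - t / q) * (t * q ^+ j.+1) = (weightP q t s j - 1) / s.
  rewrite /weightP [q ^+ j.+1]exprS; move: sP; move: (q ^+ j) => x sP; field; nz.
have c0 : weight0 q t s - t / q = (weight0 q t s - 1) / s.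
  by rewrite /weight0; field; nz.
have cM : (weightM q t s j - t / q) * (q / (t * q ^+ j)) = (weightM q t s j - 1) / s.
  have x0 := expf_neq0 j q0.
  have sM' : t * q ^+ j - q * s != 0.
    by apply: (neq0_of_div (d := t * q ^+ j) sM); field; nz.
  by rewrite /weightM; move: x0 sM'; move: (q ^+ j) => x x0 sM'; field; nz.
have u12 : u1 i * u2 i = 1 by rewrite mulrACA !mulfV ?mulr1 ?n1.
rewrite /level1_poly u12 !expr1n !(mulr1, divr1).
have -> : weightP q t 0 j = 1 by rewrite /weightP !mulr0 !subr0 divr1.
have -> : weight0 q t 0 = 1 by rewrite /weight0 !mul0r !subr0 divr1.
have -> : weightM q t 0 j = 1 by rewrite /weightM !(mulr0, mul0r) !subr0 divr1.
move: cP c0 cM; move: (weightP _ _ _ _) (weight0 _ _ _) (weightM _ _ _ _) => wP w0 wM cP c0 cM.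
move: (mac j.+2 _ _) (mac j _ _) (mac j.-2 _ _) (pieri j.+1 + _) (_ * pieri _) A => m2 m1 m3 x y a.
transitivity (2 * kappa * (p00 * E * mi * m1) + a * p00 * E * mi *
  ((w0 - t / q) * x * m1 + (wP - t / q) * (t * q ^+ j.+1) * m2
   + (wM - t / q) * (q / (t * q ^+ j)) * y * m3)); first by ring.
rewrite cP cM c0; ring.
Qed.

End FirstOrder.

(** * Gaussian integrals of Laurent polynomials in exponentials *)

Section Gaussian.
Local Open Scope complex_scope.
Variables (R : realType) (g : R).
Hypothesis g_gt0 : 0 < g.
Local Notation C := R[i].
Local Notation mu := (@lebesgue_measure R).

Definition gauss_exp (k : int) (x : R) : R := expR (- (x ^+ 2 / (2 * g))) * expR x ^ k.

Definition gauss_moment (k : int) : R := Num.sqrt (2 * pi * g) * expR (g / 2) ^ (k * k).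

Lemma expR_exprz (x : R) (k : int) : expR x ^ k = expR (k%:~R * x).
Proof.
case: k => n; first by rewrite -exprnP -expRM_natl pmulrn.
by rewrite NegzE -exprnN -expRM_natl -expRN mulrNz mulNr pmulrn.
Qed.

(** Completing the square: the weight times e^(kx) is a multiple of the normal density of mean gk
    and variance g, so integrability and value come from the normal law. *)
Lemma gauss_exp_pdf k :
  gauss_exp k = fun x => gauss_moment k * normal_pdf (g * k%:~R) (Num.sqrt g) x.
Proof.
have g0 : g != 0 by rewrite gt_eqF.
have sg0 : Num.sqrt g != 0 by rewrite gt_eqF // sqrtr_gt0.
apply/funext => x; rewrite normal_pdfE // /normal_peak /normal_fun sqr_sqrtr ?ltW //.
have -> : g * pi *+ 2 = 2 * pi * g by rewrite -mulr_natl; ring.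
rewrite /gauss_exp /gauss_moment mulrACA divff ?mul1r; last first.
  by rewrite gt_eqF // sqrtr_gt0 !mulr_gt0 // pi_gt0.
rewrite !expR_exprz -!expRD; congr expR; rewrite intrM; move: (k%:~R) => z.
by field; nz.
Qed.

Lemma integrable_gauss_exp k : mu.-integrable [set: R] (EFin \o gauss_exp k).
Proof.
rewrite gauss_exp_pdf.
exact: (@integrableZl _ _ _ mu _ measurableT _ _ (integrable_normal_pdf _ _)).
Qed.

Lemma Rintegral_gauss_exp k :
  \int[mu]_(x in [set: R]) gauss_exp k x = gauss_moment k.
Proof.
rewrite gauss_exp_pdf RintegralZl //; last exact: integrable_normal_pdf.
by rewrite /Rintegral integral_normal_pdf mulr1.
Qed.

Lemma Rintegral_gauss_sum (T : Type) (l : seq T) (r : T -> R) (k : T -> int) :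
  mu.-integrable [set: R] (EFin \o (fun x => \sum_(m <- l) r m * gauss_exp (k m) x)) /\
  \int[mu]_(x in [set: R]) (\sum_(m <- l) r m * gauss_exp (k m) x)
    = \sum_(m <- l) r m * gauss_moment (k m).
Proof.
have intZ c j : mu.-integrable [set: R] (EFin \o (fun x => c * gauss_exp j x)).
  exact: (@integrableZl _ _ _ mu _ measurableT _ _ (integrable_gauss_exp j)).
elim: l => [|m l [IHi IHv]].
  have -> : (fun x => \sum_(m <- [::]) r m * gauss_exp (k m) x) = (fun x => 0 * gauss_exp 0 x).
    by apply/funext => x; rewrite big_nil mul0r.
  split; first exact: intZ.
  by rewrite RintegralZl // ?mul0r ?big_nil //; exact: integrable_gauss_exp.
have -> : (fun x => \sum_(m <- m :: l) r m * gauss_exp (k m) x) =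
    (fun x => r m * gauss_exp (k m) x + \sum_(m <- l) r m * gauss_exp (k m) x).
  by apply/funext => x; rewrite big_cons.
split.
  exact: (@integrableD _ _ _ mu _ measurableT _ _ (intZ _ _) IHi).
rewrite RintegralD //.
rewrite RintegralZl //; last exact: integrable_gauss_exp.
by rewrite IHv big_cons Rintegral_gauss_exp.
Qed.

Lemma sum_complex (T : Type) (l : seq T) (c : T -> C) (r : T -> R) :
  \sum_(m <- l) c m * (r m)%:C =
  Complex (\sum_(m <- l) complex.Re (c m) * r m) (\sum_(m <- l) complex.Im (c m) * r m).
Proof.
elim: l => [|m l IH]; first by rewrite !big_nil.
rewrite !big_cons IH; case: (c m) => a b /=.
by apply/eqP; rewrite eq_complex /= !mulr0 subr0 add0r !eqxx.
Qed.

Lemma cintegral_gauss_sum (l : seq (C * int)) :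
  cintegral (fun x : R => real_complex R (expR (- (x ^+ 2 / (2 * g)))) *
     \sum_(m <- l) m.1 * (expR x)%:C ^ m.2)
  = \sum_(m <- l) m.1 * (gauss_moment m.2)%:C.
Proof.
have E x : real_complex R (expR (- (x ^+ 2 / (2 * g)))) *
     \sum_(m <- l) m.1 * (expR x)%:C ^ m.2 =
     Complex (\sum_(m <- l) complex.Re m.1 * gauss_exp m.2 x)
             (\sum_(m <- l) complex.Im m.1 * gauss_exp m.2 x).
  rewrite -sum_complex mulr_sumr; apply: eq_bigr => m _.
  by rewrite /gauss_exp rmorphM mulrCA /= fmorphXz.
rewrite (_ : (fun x : R => _) = fun x => Complex
    (\sum_(m <- l) complex.Re m.1 * gauss_exp m.2 x)
    (\sum_(m <- l) complex.Im m.1 * gauss_exp m.2 x)); last first.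
  by apply/funext => x; rewrite E.
rewrite /cintegral sum_complex /=; congr Complex.
  exact: (Rintegral_gauss_sum l (fun m => complex.Re m.1) snd).2.
exact: (Rintegral_gauss_sum l (fun m => complex.Im m.1) snd).2.
Qed.

(** The inner integral of a finite sum of monomials is again a Laurent polynomial in e^(x_1), so the
    iterated integral is two uses of the one-variable formula; the two factors
    [Num.sqrt (2 * pi * g)] cancel the prefactor. *)
Lemma gauss_integral2_rep (F : C -> C -> C) l : laurent_rep F l ->
  gauss_integral2 g (fun x1 x2 => F (expR x1)%:C (expR x2)%:C)
  = \sum_(m <- l) m.1.1 * (expR (g / 2))%:C ^ (m.1.2 * m.1.2) * (expR (g / 2))%:C ^ (m.2 * m.2).
Proof.
move=> Fl; rewrite /gauss_integral2.
have e0 (x : R) : (expR x)%:C != 0 by rewrite fmorph_eq0 gt_eqF // expR_gt0.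
have inner x1 : cintegral (fun x2 : R => real_complex R (expR (- (x2 ^+ 2 / (2 * g))))
    * F (expR x1)%:C (expR x2)%:C)
  = \sum_(m <- l) (m.1.1 * (gauss_moment m.2)%:C) * (expR x1)%:C ^ m.1.2.
  transitivity (\sum_(m <- [seq (m.1.1 * (expR x1)%:C ^ m.1.2, m.2) | m <- l])
      m.1 * (gauss_moment m.2)%:C).
    rewrite -cintegral_gauss_sum; congr cintegral; apply/funext => x2.
    by rewrite Fl // big_map.
  by rewrite big_map; apply: eq_bigr => m _ /=; rewrite mulrAC.
rewrite (_ : cintegral _ = \sum_(m <- [seq (m.1.1 * (gauss_moment m.2)%:C, m.1.2) | m <- l])
      m.1 * (gauss_moment m.2)%:C); last first.
  rewrite -cintegral_gauss_sum; congr cintegral; apply/funext => x1.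
  by rewrite inner big_map.
rewrite big_map mulr_sumr; apply: eq_bigr => m _ /=.
rewrite /gauss_moment !rmorphM !fmorphXz.
have S2 : (Num.sqrt (2 * pi * g))%:C ^+ 2 = (2 * pi * g)%:C.
  by rewrite -rmorphXn sqr_sqrtr // !mulr_ge0 ?pi_ge0 // ltW.
have p0 : (2 * pi * g)%:C != 0.
  by rewrite fmorph_eq0 gt_eqF // !mulr_gt0 // pi_gt0.
transitivity ((2 * pi * g)%:C^-1 * (Num.sqrt (2 * pi * g))%:C ^+ 2 *
  (m.1.1 * (expR (g / 2))%:C ^ (m.1.2 * m.1.2) * (expR (g / 2))%:C ^ (m.2 * m.2))).
  by rewrite -fmorphV /=; ring.
by rewrite S2 mulVf // mul1r.
Qed.

End Gaussian.

(** * Nonvanishing of M_j at the spectral points *)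

Section Positivity.
Variables (R : realFieldType) (q t : R).
Hypotheses (q1 : 1 < q) (t1 : 1 < t).

Let q0 : q != 0. Proof. by rewrite gt_eqF // (lt_trans ltr01). Qed.
Let t0 : t != 0. Proof. by rewrite gt_eqF // (lt_trans ltr01). Qed.

Lemma one_sub_q_lt0 n : 1 - q ^+ n.+1 < 0.
Proof. by rewrite subr_lt0 exprn_egt1. Qed.

Lemma one_sub_tq_lt0 n : 1 - t * q ^+ n < 0.
Proof. by rewrite subr_lt0 (lt_le_trans t1) // ler_peMr ?exprn_ege1 ?ltW // (lt_trans ltr01). Qed.

Lemma rfact_gt0 (n : nat) : 0 < rfact q t n.
Proof.
elim: n => [|n IH]; first by rewrite rfact0 ltr01.
by rewrite rfactS mulr_gt0 // nmulr_rgt0 ?invr_lt0 ?one_sub_q_lt0 ?one_sub_tq_lt0.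
Qed.

(** For [q, t > 1] numerators and denominators in [rfact] are all negative, so every coefficient of
    M_j is positive. This is not visible from the recursion [macS], which has a minus sign. *)
Lemma mac_gt0 j x1 x2 : 0 < x1 -> 0 < x2 -> 0 < mac q t j x1 x2.
Proof.
move=> x10 x20; rewrite -(rgen_mac q0 t0) ?gt_eqF // => [|n|n]; last 2 first.
- by rewrite lt_eqF // one_sub_q_lt0.
- by rewrite lt_eqF // one_sub_tq_lt0.
have c0 (n : 'I_j.+1) : 0 < rogers q t j n * (x2 / x1) ^+ n.
  apply: mulr_gt0; last by rewrite exprn_gt0 ?divr_gt0.
  rewrite /rogers subzn; last by rewrite -ltnS.
  by rewrite divr_gt0 ?mulr_gt0 ?rfact_gt0.
rewrite mulr_gt0 ?exprn_gt0 // /rgen big_ord_recl ltr_pwDl ?sumr_ge0 //.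
by move=> n _; rewrite ltW.
Qed.

End Positivity.

Lemma pieri_rmorph (F G : fieldType) (f : {rmorphism F -> G}) (q t : F) j :
  pieri (f q) (f t) j = f (pieri q t j).
Proof. by rewrite /pieri !(fmorph_div, rmorphM, rmorphB, rmorph1, rmorphXn). Qed.

Lemma mac_rmorph (F G : fieldType) (f : {rmorphism F -> G}) (q t x1 x2 : F) j :
  mac (f q) (f t) j (f x1) (f x2) = f (mac q t j x1 x2).
Proof.
elim/ltn_ind: j => -[|j] IH; first by rewrite /mac rmorph1.
rewrite [LHS]macS [mac q t j.+1 x1 x2]macS pieri_rmorph; move: (pieri q t j) => a.
by rewrite rmorphB !rmorphM rmorphD !IH //; case: (j).
Qed.

(** * Power series modulo p ^ 2 and theta functions *)

Section Series.
Variable K : fieldType.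

Lemma smul0 (f g : nat -> K) : smul f g 0 = f 0%N * g 0%N.
Proof. by rewrite /smul big_ord1. Qed.

Lemma smul1 (f g : nat -> K) : smul f g 1 = f 0%N * g 1%N + f 1%N * g 0%N.
Proof. by rewrite /smul !big_ord_recl big_ord0 addr0. Qed.

Lemma theta0 (x : K) : theta x 0 = 1 - x.
Proof.
rewrite /theta big_ord1 expr0 mulr1 expr1 coefM0 !coefB !coef1 coefC coefCM coefX /=.
by rewrite mulr0 subr0 mulr1.
Qed.

(** Besides [1 - x], only the factors 1 - p / x and 1 - p x reach degree 1. *)
Lemma theta1 (x : K) : theta x 1 = - (x + x^-1) * theta x 0.
Proof.
rewrite theta0 /theta !big_ord_recl big_ord0 mulr1 !(coefM1, coefM0) !coefB !coef1 !coefCM.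
rewrite !coefXn /= !(mulr0, mulr1, subr0, mul1r, mul0r, addr0, add0r, sub0r).
ring.
Qed.

Lemma big_smul0 (I : Type) (l : seq I) (f : I -> nat -> K) :
  (\big[@smul K/@sone K]_(m <- l) f m) 0%N = \prod_(m <- l) f m 0%N.
Proof. by elim: l => [|m l IH]; rewrite ?big_nil // !big_cons smul0 IH. Qed.

(* Multiplicativity turns the coefficient of degree 1 into a logarithmic derivative. *)
Lemma big_smul1 (I : Type) (l : seq I) (f : I -> nat -> K) (c : I -> K) :
  (forall m, f m 1%N = c m * f m 0%N) ->
  (\big[@smul K/@sone K]_(m <- l) f m) 1%N = (\sum_(m <- l) c m) * \prod_(m <- l) f m 0%N.
Proof.
move=> fc; elim: l => [|m l IH]; first by rewrite !big_nil mul0r.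
by rewrite !big_cons smul1 IH big_smul0 fc; ring.
Qed.

End Series.

Section Theta.
Variables (K : fieldType) (q : K) (b : nat).
Hypothesis q0 : q != 0.

Definition theta_kernel (r r' : K) : nat -> K :=
  \big[@smul K/@sone K]_(0 <= m < b) smul (theta (q ^+ m * r)) (theta (q ^+ m * r')).

Lemma theta_kernel0 x1 x2 : theta_kernel (x1 / x2) (x2 / x1) 0 = delta q b x1 x2.
Proof.
rewrite /theta_kernel big_smul0 big_mkord; apply: eq_bigr => m _.
by rewrite smul0 !theta0.
Qed.

Lemma theta_kernel1 x1 x2 : x1 != 0 -> x2 != 0 -> theta_kernel (x1 / x2) (x2 / x1) 1 =
  - (\sum_(m < b) (q ^+ m + q ^- m)) * (x1 / x2 + x2 / x1) * delta q b x1 x2.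
Proof.
move=> x10 x20.
rewrite /theta_kernel (big_smul1 _ (c := fun m => - ((q ^+ m + q ^- m) * (x1 / x2 + x2 / x1)))).
  have T0 := theta_kernel0 x1 x2; rewrite /theta_kernel big_smul0 in T0.
  by rewrite T0 big_mkord sumrN -mulr_suml; ring.
move=> m; rewrite smul1 smul0 !theta1.
move: (theta _ 0) (theta _ 0) => a c.
by have := expf_neq0 m q0; move: (q ^+ m) => y y0; field; nz.
Qed.

End Theta.

Section SeriesValues.
Variables (K : fieldType) (q t s : K).
Hypotheses (q0 : q != 0) (t0 : t != 0).
Hypotheses (qn : forall n : nat, 1 - q ^+ n.+1 != 0).
Hypotheses (tqn : forall n : nat, 1 - t * q ^+ n != 0).
Hypothesis s1 : 1 - s != 0.
Hypothesis sP : forall j : nat, 1 - t * q * q ^+ j * s != 0.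
Hypothesis sM : forall j : nat, 1 - q * s / (t * q ^+ j) != 0.
Variables (j : nat) (x1 x2 : K).
Hypotheses (x10 : x1 != 0) (x20 : x2 != 0).

Lemma P_s0 : P_s q t s j x1 x2 0 = mac q t j x1 x2.
Proof.
rewrite -(laurent_rogers q0 t0 qn tqn) //; congr laurent.
by apply/funext => d; rewrite coef_s0.
Qed.

Lemma P_s1 : P_s q t s j x1 x2 1 = level1_poly q t s j x1 x2.
Proof.
rewrite -(laurent_level1 q0 t0 qn tqn) //; congr laurent.
by apply/funext => d; rewrite coef_s1.
Qed.

Lemma P_00E : P_0 q t j x1 x2 0 = mac q t j x1 x2.
Proof.
rewrite -(laurent_rogers q0 t0 qn tqn) //; congr laurent.
by apply/funext => d; rewrite coef_00.
Qed.

Lemma P_01 : P_0 q t j x1 x2 1 = level1_poly q t 0 j x1 x2.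
Proof.
rewrite -(laurent_level1 q0 t0 qn tqn) //; congr laurent.
by apply/funext => d; rewrite coef_01.
Qed.

Lemma P_ps0 : P_ps q t s j x1 x2 0 = mac q t j x1 x2.
Proof.
rewrite -(laurent_rogers q0 t0 qn tqn) //; congr laurent.
by apply/funext => d; rewrite coef_ps0.
Qed.

Lemma P_ps1 : P_ps q t s j x1 x2 1 = level1_poly q t 0 j x1 x2.
Proof.
rewrite -(laurent_level1 q0 t0 qn tqn) //; congr laurent.
by apply/funext => d; rewrite coef_ps1.
Qed.

End SeriesValues.


(** * The identity for an abstract Gaussian functional *)

Section SeriesIdentity.
Variables (K : fieldType) (qh s : K) (b : nat) (L : (K -> K -> K) -> K).
Local Notation q := (qh ^+ 2).
Local Notation beta := b.+1.
Local Notation t := (q ^+ beta).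
Local Notation th := (qh ^+ beta).
Hypotheses (qh0 : qh != 0) (s0 : s != 0).
Hypotheses (qn : forall n : nat, 1 - q ^+ n.+1 != 0).
Hypotheses (tqn : forall n : nat, 1 - t * q ^+ n != 0).
Hypothesis s1 : 1 - s != 0.
Hypothesis sP : forall j : nat, 1 - t * q * q ^+ j * s != 0.
Hypothesis sM : forall j : nat, 1 - q * s / (t * q ^+ j) != 0.
Hypothesis L_rep : forall F l, laurent_rep F l ->
  L F = \sum_(m <- l) m.1.1 * qh ^ (m.1.2 * m.1.2) * qh ^ (m.2 * m.2).

Let q0 : q != 0. Proof. by rewrite expf_neq0. Qed.
Let t0 : t != 0. Proof. by rewrite expf_neq0. Qed.

Definition norm_const (N : nat) : K :=
  if N is 0%N then pairing qh b L 0 0 else 2 * kappa qh b * pairing qh b L 0 0.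

Definition integrand (i j N : nat) (x1 x2 : K) : K :=
  smul (smul (P_ps q t s i x1 x2) (P_s q t s j x1 x2))
    (theta_kernel q beta (x1 / x2) (x2 / x1)) N.

Lemma integrand0 i j x1 x2 : x1 != 0 -> x2 != 0 ->
  integrand i j 0 x1 x2 = mac q t i x1 x2 * mac q t j x1 x2 * delta q beta x1 x2.
Proof.
move=> x10 x20; rewrite /integrand !smul0 theta_kernel0.
by rewrite (P_ps0 s q0 t0 qn tqn) // (P_s0 s q0 t0 qn tqn).
Qed.

Lemma integrand1 i j x1 x2 : x1 != 0 -> x2 != 0 ->
  integrand i j 1 x1 x2 = first_order qh b s i j x1 x2.
Proof.
move=> x10 x20; rewrite /integrand !smul1 !smul0 theta_kernel0 theta_kernel1 //.
rewrite (P_ps0 s q0 t0 qn tqn) // (P_s0 s q0 t0 qn tqn) //.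
by rewrite (P_ps1 s q0 t0 qn tqn) // (P_s1 q0 t0 qn tqn s1 sP sM).
Qed.

(** Numerator and denominator of the quotient both start with M_j at the spectral point, which has
    to be nonzero for the division; the quotient is then 1 plus a multiple of p, and that multiple
    is the one found in [L_first_order]. *)
Lemma series_identity i j N (u1 := th * qh ^+ i) (u2 := th^-1 * qh ^- i) :
  (N < 2)%N -> mac q t j u1 u2 != 0 ->
  L (integrand i j N) =
  qh ^+ (i * (i + beta) + i * j + j * (j + beta))
  * P_00 q t i th th^-1 * P_00 q t j u1 u2
  * smul (sdiv (sscale s (P_s q t s j u1 u2)) (sscale s (P_0 q t j u1 u2))) norm_const N.
Proof.
move=> N2 M0.
have thn0 : th != 0 by rewrite expf_neq0.
have thV0 : th^-1 != 0 by rewrite invr_eq0.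
have u10 : u1 != 0 by rewrite mulf_neq0 ?expf_neq0.
have u20 : u2 != 0 by rewrite mulf_neq0 ?invr_neq0 ?expf_neq0.
have P0 := P_00E q0 t0 qn tqn; have Ps0 := P_s0 s q0 t0 qn tqn.
rewrite /P_00 (P0 i th) // (P0 j u1) //.
case: N N2 => [|[|//]] _.
  rewrite smul0 sdiv0 /sscale !divr1 (Ps0 j u1) // (P0 j u1) // divff // mul1r.
  have <- : pairing qh b L i j = L (integrand i j 0).
    apply: (L_ext L_rep) => [|x1 x2 x10 x20]; last by rewrite integrand0.
    apply: is_laurentM; last exact: is_laurent_delta.
    by apply: is_laurentM; exact: is_laurent_mac.
  rewrite (pairing_eval qh0 tqn L_rep) /norm_const -/u1 -/u2.
  by move: (pairing _ _ _ 0 0) (mac _ _ i th _) (mac _ _ j u1 _) (qh ^+ (_ + _ + _)) => *; ring.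
have <- : L (first_order qh b s i j) = L (integrand i j 1).
  apply: (L_ext L_rep) => [|x1 x2 x10 x20]; last by rewrite integrand1.
  by rewrite /first_order /level1_poly; laurent.
rewrite (L_first_order qh0 qn tqn L_rep) // smul1 sdiv0 sdiv1 /sscale !divr1 !expr1.
rewrite (Ps0 j u1) // (P0 j u1) // (P_s1 q0 t0 qn tqn s1 sP sM) // (P_01 q0 t0 qn tqn) //.
rewrite /norm_const -/u1 -/u2.
move: M0; move: (pairing _ _ _ _ _) (mac _ _ _ u1 _) (mac _ _ _ th _) (qh ^+ (_ + _ + _)).
move: (level1_poly _ _ s _ _ _) (level1_poly _ _ 0 _ _ _) (kappa _ _) => l1 l2 k p m1 m2 E m10.
by field; nz.
Qed.

End SeriesIdentity.

(** The complex value is the image of a real one, where positivity applies. *)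
Lemma mac_image_neq0 (R : realFieldType) (K : fieldType) (f : {rmorphism R -> K}) (h : R)
    (b i j : nat) (qh := f h) : 1 < h ->
  mac (qh ^+ 2) ((qh ^+ 2) ^+ b.+1) j (qh ^+ b.+1 * qh ^+ i) ((qh ^+ b.+1)^-1 * qh ^- i) != 0.
Proof.
move=> h1; have h0 : 0 < h by rewrite (lt_trans ltr01).
have -> : mac (qh ^+ 2) ((qh ^+ 2) ^+ b.+1) j (qh ^+ b.+1 * qh ^+ i) ((qh ^+ b.+1)^-1 * qh ^- i)
   = f (mac (h ^+ 2) ((h ^+ 2) ^+ b.+1) j (h ^+ b.+1 * h ^+ i) ((h ^+ b.+1)^-1 * h ^- i)).
  by rewrite -mac_rmorph !rmorphM !fmorphV !rmorphXn.
rewrite fmorph_eq0 gt_eqF // mac_gt0 ?exprn_egt1 //.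
  by rewrite mulr_gt0 ?exprn_gt0.
by rewrite mulr_gt0 ?invr_gt0 ?exprn_gt0.
Qed.

Local Open Scope complex_scope.

Theorem theorem9 (R : realType) (g : R) (beta : nat) (s : R[i])
    (g_gt0 : 0 < g) (beta_ge1 : (1 <= beta)%N) (s_neq0 : s != 0)
    (s_notin : forall k : int, s != (expR g)%:C ^ k) :
  let q := (expR g)%:C in
  let t := (expR (beta%:R * g))%:C in
  let qh := (expR (g / 2))%:C in
  let th := (expR (beta%:R * g / 2))%:C in
  exists Z : nat -> R[i], forall i j N : nat, (N < 2)%N ->
    let u1 := th * qh ^+ i in
    let u2 := th^-1 * qh ^- i in
    gauss_integral2 g (fun x1 x2 =>
      let e1 := (expR x1)%:C in
      let e2 := (expR x2)%:C in
      smul (smul (P_ps q t s i e1 e2) (P_s q t s j e1 e2))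
        (\big[@smul _/@sone _]_(0 <= m < beta)
           smul (theta (q ^+ m * (expR (x1 - x2))%:C))
                (theta (q ^+ m * (expR (x2 - x1))%:C))) N)
    = qh ^+ (i * (i + beta) + i * j + j * (j + beta))
      * P_00 q t i th th^-1 * P_00 q t j u1 u2
      * smul (sdiv (sscale s (P_s q t s j u1 u2)) (sscale s (P_0 q t j u1 u2))) Z N.
Proof.
(* Writing [beta] as [b.+1] provides the factor [m = 0] of the kernel, from which x_1 - x_2 is split
   off. *)
case: beta beta_ge1 => // b _ q t qh th.
have qE : q = qh ^+ 2.
  by rewrite /q /qh -rmorphXn -expRM_natl; congr (_%:C); congr expR; field.
have tE : t = (qh ^+ 2) ^+ b.+1 by rewrite /t -qE /q -rmorphXn -expRM_natl.
have thE : th = qh ^+ b.+1 by rewrite /th /qh -rmorphXn -expRM_natl mulrA.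
have ne0 (x : R) : (expR x)%:C != 0 by rewrite fmorph_eq0 gt_eqF // expR_gt0.
have [q0 t0 qh0 th0] : [/\ q != 0, t != 0, qh != 0 & th != 0] by split; exact: ne0.
have q1 : 1 < expR g by rewrite expR_gt1.
have t1 : 1 < expR (b.+1%:R * g) by rewrite expR_gt1 mulr_gt0.
have lt0C (x : R) : x < 0 -> x%:C != 0 by move=> x0; rewrite fmorph_eq0 lt_eqF.
have qn n : 1 - q ^+ n.+1 != 0.
  by have := lt0C _ (one_sub_q_lt0 q1 n); rewrite rmorphB rmorphXn rmorph1.
have tqn n : 1 - t * q ^+ n != 0.
  by have := lt0C _ (one_sub_tq_lt0 q1 t1 n); rewrite rmorphB rmorphM rmorphXn rmorph1.
have sk (k : int) (x : R[i]) : x * q ^ k = 1 -> x = q ^ (- k).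
  move=> xk; rewrite -invr_expz -[x](mulfK (expfz_neq0 k q0)) xk mul1r //.
have s1 : 1 - s != 0.
  by rewrite subr_eq0 eq_sym; have := s_notin 0; rewrite expr0z.
have tq : t = q ^+ b.+1 by rewrite tE -qE.
(* As [t] is a power of [q], the poles in [s] of the three weights all lie at integer powers of [q]:
   here [- (beta + 1 + j)], above 0 and below [beta - 1 + j]. *)
have sP j : 1 - t * q * q ^+ j * s != 0.
  rewrite subr_eq0 eq_sym; apply: contra (s_notin (- (b.+1 + 1 + j)%N%:Z)) => /eqP e.
  apply/eqP; apply: sk; rewrite -exprnP !exprD expr1 -tq mulrC; exact: e.
have sM j : 1 - q * s / (t * q ^+ j) != 0.
  rewrite subr_eq0 eq_sym; apply: contra (s_notin (b + j)%N) => /eqP e.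
  have tj : t * q ^+ j != 0 by rewrite mulf_neq0 ?expf_neq0.
  apply/eqP; apply: (mulfI q0); rewrite -[q * s](divfK tj) e mul1r.
  by rewrite tq -exprnP exprD mulrA -exprS.
pose L F := gauss_integral2 g (fun x1 x2 => F (expR x1)%:C (expR x2)%:C).
have L_rep F l : laurent_rep F l ->
    L F = \sum_(m <- l) m.1.1 * qh ^ (m.1.2 * m.1.2) * qh ^ (m.2 * m.2).
  exact: gauss_integral2_rep.
have eB (x y : R) : (expR (x - y))%:C = (expR x)%:C / (expR y)%:C.
  by rewrite expRD expRN rmorphM fmorphV.
rewrite qE in qn sP sM; rewrite tE in tqn sP sM; rewrite qE in tqn.
exists (norm_const qh b L) => i j N N2 u1 u2.
have h1 : 1 < expR (g / 2) by rewrite expR_gt1 divr_gt0.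
have M0 := mac_image_neq0 (real_complex R) b i j h1.
have H0 := @series_identity _ qh s b L qh0 s_neq0 qn tqn s1 sP sM L_rep i j N N2.
have H := H0 M0; rewrite {}/u1 {}/u2 qE tE thE -H /L {M0 H0 H}.
apply: (congr1 (gauss_integral2 g)); apply: funext => x1; apply: funext => x2.
by cbv zeta; rewrite /integrand /theta_kernel (eB x1 x2) (eB x2 x1).
Qed.
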